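(* Let $d,q,n\in\mathbb N^*$. Let $(X_k)_{k=0,\dots,n}$ be the $\mathbb R^d$-valued ARCH model $X_{k+1}=X_k+\vartheta_k(X_k)Z_{k+1}$, $k=0,\dots,n-1$, where the white noise $(Z_k)_{k=1,\dots,n}$ is a sequence of $\mathbb R^q$-valued random vectors with radial distributions, independent of $X_0$, the initial random vector $X_0$ is integrable, and the Borel functions $\vartheta_k:\mathbb R^d\to\mathbb M_{d,q}$, $k=0,\dots,n-1$, are convex (in the matrix sense recalled in the context) with linear growth. Let $g_0:\mathbb R^d\to\mathbb R^d$ be a bounded Borel function and assume that $g_0(X_0)\le_{cvx}X_0$. (a) Truncation. Let $(A_k)_{k=1,\dots,n}$ be an $n$-tuple of Borel subsets of $\mathbb R^q$ satisfying $\mathbb E[Z_k\mathbf 1_{\{Z_k\in A_k\}}]=0$, $k=1,\dots,n$, let $\breve Z_k=Z_k\mathbf 1_{\{Z_k\in A_k\}}$ and let $\breve X^A_0=g_0(X_0)$, $\breve X^A_{k+1}=\breve X^A_k+\vartheta_k(\breve X_k^A)\breve Z_{k+1}$, $k=0,\dots,n-1$. Then $$(\breve X^A_k)_{k=0,\dots,n}\le_{cvx}(X_k)_{k=0,\dots,n}.$$ (b) Quantization. For $k=1,\dots,n$, let $\breve Z_k=\widehat Z_k^{vor}$ be a stationary Voronoi quantization of $Z_k$, and let $\breve X_0=g_0(X_0)$, $\breve X_{k+1}=\breve X_k+\vartheta_k(\breve X_k)\breve Z_{k+1}$, $k=0,\dots,n-1$. Then $$(\breve X_k)_{k=0,\dots,n}\le_{cvx}(X_k)_{k=0,\dots,n}.$$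 (c) Scalar setting. When $d=q=1$, if the assumption of convexity of the $\vartheta_k$ in the matrix sense is replaced by the assumption that $|\vartheta_k|$ is convex for every $k=0,\dots,n-1$ (all other assumptions being kept), then the conclusions of (a) and (b) hold true.
   Context: $\mathbb M_{d,q}$ is the space of real $d\times q$ matrices. For integrable random vectors $X,Y$ with values in the same $\mathbb R^m$, $X\le_{cvx}Y$ means $\mathbb E\,\varphi(X)\le\mathbb E\,\varphi(Y)$ for every convex $\varphi:\mathbb R^m\to\mathbb R$ (expectations in $\mathbb R\cup\{+\infty\}$); for processes $(X_k)_{k=0,\dots,n}$ it is understood for the $(\mathbb R^d)^{n+1}$-valued vectors $(X_0,\dots,X_n)$. A function $\vartheta:\mathbb R^d\to\mathbb M_{d,q}$ is convex (in the matrix sense) if for all $x,y\in\mathbb R^d$ and $\alpha\in[0,1]$ there exists an orthogonal matrix $O=O_{x,y,\alpha}\in\mathbb M_{q,q}$ such that $$\vartheta\vartheta^*(\alpha x+(1-\alpha)y)\le\big(\alpha\vartheta(x)+(1-\alpha)\vartheta(y)O\big)\big(\alpha\vartheta(x)+(1-\alpha)\vartheta(y)O\big)^*,$$ where $\le$ is the usual (positive semidefinite) order on symmetric matrices and $\vartheta\vartheta^*(x)=\vartheta(x)\vartheta(x)^*$. Linear growth means that the norm of $\vartheta(x)$ is bounded by $C(1+|x|)$ for some constant $C$. A white noise is a sequence of independent square integrable centered $\mathbb R^q$-valued random vectors with identity covariance matrix. A random vector $Z$ in $\mathbb R^q$ has a radial distribution if $OZ$ has the same distribution as $Z$ for every orthogonal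 $O\in\mathbb M_{q,q}$. A stationary Voronoi quantization of $Z_k$ is a random vector $\widehat Z_k^{vor}=\mathrm{Proj}_\Gamma(Z_k)$, where $\Gamma\subset\mathbb R^q$ is a finite set and $\mathrm{Proj}_\Gamma:\mathbb R^q\to\Gamma$ is a Borel nearest neighbour projection ($|\xi-\mathrm{Proj}_\Gamma(\xi)|=\mathrm{dist}(\xi,\Gamma)$ for all $\xi$), such that $\mathbb E[Z_k\mid\widehat Z_k^{vor}]=\widehat Z_k^{vor}$. *)

(* Defs.v *)
From HB Require Import structures.
From mathcomp Require Import all_boot all_order all_algebra.
From mathcomp Require Import all_classical all_reals all_analysis.

Set Implicit Arguments.
Unset Strict Implicit.
Unset Printing Implicit Defensive.

Import Order.TTheory GRing.Theory Num.Theory.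
Import numFieldNormedType.Exports.

Local Open Scope classical_set_scope.
Local Open Scope ring_scope.

(* [R^d] is ['cV[R]_d], and [(R^d)^m] is ['M[R]_(d, m)], the vectors being the
   columns.  All matrix spaces carry the Borel sigma-algebra of their (product)
   topology. *)

Definition mx_borel_display : measure_display.
Proof. exact: default_measure_display. Qed.

Section matrix_borel.
Context (R : realType) (m n : nat).

Definition mx_borel : set (set 'M[R]_(m, n)) := <<s open >>.

Let mx_borel0 : mx_borel set0.
Proof. exact: sigma_algebra0. Qed.

Let mx_borelC A : mx_borel A -> mx_borel (~` A).
Proof. exact: sigma_algebraC. Qed.

Let mx_borelU (F : (set 'M[R]_(m, n))^nat) :
  (forall i, mx_borel (F i)) -> mx_borel (\bigcup_i F i).
Proof. exact: sigma_algebra_bigcup. Qed.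

HB.instance Definition _ := @isMeasurable.Build mx_borel_display
  'M[R]_(m, n) mx_borel mx_borel0 mx_borelC mx_borelU.

End matrix_borel.

Section matrices.
Context (R : realType).

(* The library norm on matrices is the max norm; this is the Frobenius norm,
   i.e. the Euclidean norm on column vectors. *)
Definition enorm (m n : nat) (A : 'M[R]_(m, n)) : R :=
  Num.sqrt (\sum_i \sum_j A i j ^+ 2).

Definition orthogonal_mx (q : nat) (O : 'M[R]_q) : Prop := O *m O^T = 1%:M.

(* Only meant for symmetric [A] and [B]. *)
Definition psd_le (d : nat) (A B : 'M[R]_d) : Prop :=
  forall u : 'cV[R]_d, 0 <= (u^T *m (B - A) *m u) 0 0.

Definition matrix_convex (d q : nat) (theta : 'cV[R]_d -> 'M[R]_(d, q)) :=
  forall (x y : 'cV[R]_d) (a : R), 0 <= a <= 1 ->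
  exists2 O : 'M[R]_q, orthogonal_mx O &
    let z := a *: x + (1 - a) *: y in
    let S := a *: theta x + (1 - a) *: (theta y *m O) in
    psd_le (theta z *m (theta z)^T) (S *m S^T).

Definition linear_growth (d q : nat) (theta : 'cV[R]_d -> 'M[R]_(d, q)) :=
  exists C : R, forall x, enorm (theta x) <= C * (1 + enorm x).

Definition bounded_vfun (d : nat) (g : 'cV[R]_d -> 'cV[R]_d) :=
  exists C : R, forall x, enorm (g x) <= C.

Definition nearest_neighbour (q : nat) (Gam : set 'cV[R]_q)
    (proj : 'cV[R]_q -> 'cV[R]_q) :=
  forall xi, Gam (proj xi) /\
    enorm (xi - proj xi) = inf [set enorm (xi - g) | g in Gam].

End matrices.

Section random_vectors.
Context (dT : measure_display) (T : measurableType dT) (R : realType)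
  (P : probability T R).

Definition integrable_mx (m n : nat) (X : T -> 'M[R]_(m, n)) : Prop :=
  forall i j, P.-integrable setT (fun w => (X w i j)%:E).

(* The integrability of [X] and [Y] makes the two expectations well defined in
   [R] extended by [+oo]: a real convex function has an affine minorant. *)
Definition cvx_le (m n : nat) (X Y : T -> 'M[R]_(m, n)) : Prop :=
  [/\ integrable_mx X, integrable_mx Y &
      forall phi : 'M[R]_(m, n) -> R,
        convex_function [set: convex_lmodType 'M[R]_(m, n)] phi ->
        ('E_P[fun w => phi (X w)] <= 'E_P[fun w => phi (Y w)])%E].

Definition path_mx (d m : nat) (X : 'I_m -> T -> 'cV[R]_d) :
    T -> 'M[R]_(d, m) :=
  fun w => \matrix_(i, k) X k w i ord0.

Definition mutually_independent (n q : nat) (Z : 'I_n -> T -> 'cV[R]_q) :=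
  forall (J : {set 'I_n}) (B : 'I_n -> set 'cV[R]_q),
    (forall k, measurable (B k)) ->
    P (\bigcap_(k in [set` J]) (Z k @^-1` B k)) =
      (\prod_(k in J) P (Z k @^-1` B k))%E.

Definition independent_mx (m n p r : nat)
    (X : T -> 'M[R]_(m, n)) (Y : T -> 'M[R]_(p, r)) :=
  forall (B : set 'M[R]_(m, n)) (C : set 'M[R]_(p, r)),
    measurable B -> measurable C ->
    P (X @^-1` B `&` Y @^-1` C) = (P (X @^-1` B) * P (Y @^-1` C))%E.

Definition white_noise (n q : nat) (Z : 'I_n -> {RV P >-> 'cV[R]_q}) : Prop :=
  [/\ mutually_independent (fun k => Z k : T -> 'cV[R]_q),
      forall k i, (fun w => Z k w i ord0) \in Lfun P 2%:E,
      forall k i, ('E_P[fun w => Z k w i ord0] = 0)%E &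
      forall k i j, covariance P (fun w => Z k w i ord0) (fun w => Z k w j ord0) =
        ((i == j)%:R : R)%:E].

Definition radial (q : nat) (Z : T -> 'cV[R]_q) : Prop :=
  forall O : 'M[R]_q, orthogonal_mx O ->
  forall B : set 'cV[R]_q, measurable B ->
    pushforward P (fun w => O *m Z w) B = pushforward P Z B.

(* [W] is a version of the conditional expectation of [X] given [Y]. *)
Definition cond_expectation (m p : nat) (X : T -> 'cV[R]_m)
    (Y : T -> 'cV[R]_p) (W : T -> 'cV[R]_m) : Prop :=
  [/\ preimage_set_system setT W measurable `<=`
        preimage_set_system setT Y measurable,
      integrable_mx W &
      forall B : set 'cV[R]_p, measurable B -> forall i,
        (\int[P]_(w in Y @^-1` B) (W w i ord0)%:E =
         \int[P]_(w in Y @^-1` B) (X w i ord0)%:E)%E].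

Definition stationary_voronoi (q : nat) (Z Zh : T -> 'cV[R]_q) : Prop :=
  (exists (Gam : set 'cV[R]_q) (proj : 'cV[R]_q -> 'cV[R]_q),
    [/\ finite_set Gam, measurable_fun setT proj,
        nearest_neighbour Gam proj & Zh = proj \o Z]) /\
  cond_expectation Z Zh Zh.

Definition truncation (q : nat) (A : set 'cV[R]_q) (Z : T -> 'cV[R]_q) :
    T -> 'cV[R]_q :=
  fun w => (\1_A (Z w) : R) *: Z w.

(* [Z k], for [k < n], is the innovation of the step from [k] to [k + 1], i.e.
   the noise that is usually indexed by [k + 1]. *)
Definition arch (n d q : nat) (theta : 'I_n -> 'cV[R]_d -> 'M[R]_(d, q))
    (Z : 'I_n -> T -> 'cV[R]_q) (x0 : T -> 'cV[R]_d)
    (X : 'I_n.+1 -> T -> 'cV[R]_d) : Prop :=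
  (forall w, X ord0 w = x0 w) /\
  forall (k : 'I_n) w, let x := X (widen_ord (leqnSn n) k) w in
    X (lift ord0 k) w = x + theta k x *m Z k w.

Definition truncation_cvx_le (n d q : nat)
    (theta : 'I_n -> 'cV[R]_d -> 'M[R]_(d, q))
    (Z : 'I_n -> T -> 'cV[R]_q) (x0 : T -> 'cV[R]_d)
    (X : 'I_n.+1 -> T -> 'cV[R]_d) : Prop :=
  forall (A : 'I_n -> set 'cV[R]_q) (XA : 'I_n.+1 -> T -> 'cV[R]_d),
    (forall k, measurable (A k)) ->
    (forall k i, ('E_P[fun w => truncation (A k) (Z k) w i ord0] = 0)%E) ->
    arch theta (fun k => truncation (A k) (Z k)) x0 XA ->
    cvx_le (path_mx XA) (path_mx X).

Definition quantization_cvx_le (n d q : nat)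
    (theta : 'I_n -> 'cV[R]_d -> 'M[R]_(d, q))
    (Z : 'I_n -> T -> 'cV[R]_q) (x0 : T -> 'cV[R]_d)
    (X : 'I_n.+1 -> T -> 'cV[R]_d) : Prop :=
  forall (Zh : 'I_n -> T -> 'cV[R]_q) (Xh : 'I_n.+1 -> T -> 'cV[R]_d),
    (forall k, stationary_voronoi (Z k) (Zh k)) ->
    arch theta Zh x0 Xh ->
    cvx_le (path_mx Xh) (path_mx X).

End random_vectors.

(* Main.v *)
From HB Require Import structures.
Require Import Defs.
From mathcomp Require Import all_boot all_order all_algebra.
From mathcomp Require Import all_classical all_reals all_analysis.
From mathcomp Require Import measurable_realfun ring lra.
Import Order.TTheory GRing.Theory Num.Theory.
Import numFieldNormedType.Exports.

(** Truncation and stationary quantization both replace the noise [Z k] by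
    [f k (Z k)], where [f k] is Borel and keeps the barycentre of [Z k] on each
    atom that it creates; by Jensen's inequality, in the form
    [stationary_Rintegral_le], the mean of a convex function of [f k (Z k)] is
    at most its mean at [Z k].  What remains, [arch_cvx_le], is that one step of
    the recursion propagates the convex order.

    The step from time [k] to [k + 1] is governed by the operator sending a
    function [phi] of the path to its mean after the step ([transition]), and
    everything rests on this operator preserving convexity
    ([transition_cvx_lip]).  Given that, an induction on [k] over all convex
    [phi] proves the comparison: along the modified path, the mean of [phi] at
    time [k + 1] is at most the mean of [transition phi] at time [k], because
    independence allows freezing the past while the modified noise is replaced
    by the original one; the induction hypothesis applies to [transition phi].

    Convexity of [transition phi] follows from matrix convexity of [theta] once
    the mean of a convex [psi (M *m Z)] is known to be nondecreasing in
    [M *m M^T] for the positive semidefinite order ([radial_psd_le]); this is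
    where the radial distribution of [Z] is used.  If [M *m M^T <= N *m N^T]
    then [M = N *m C] for a contraction [C] ([psd_le_factor]).  The mean of
    [psi (N *m C *m Z)] is a convex function of [C] which does not distinguish
    orthogonal matrices from the identity, and a convex function on the unit
    ball of matrices is bounded by its values at the extreme points, that is, at
    orthogonal matrices ([contraction_max]).

    The induction is carried out for Lipschitz convex functions only: these are
    integrable along the paths, and [transition phi] is again Lipschitz because
    a convex function of linear growth is Lipschitz ([cvx_lip_growth]).  An
    arbitrary convex function is the increasing limit of the suprema of its
    affine minorants of bounded slope ([cvx_approx]), so monotone convergence
    yields the convex order ([cvx_le_of_lip]).

    In the scalar case, convexity of the absolute value of [theta] is matrix
    convexity with a sign as the orthogonal matrix ([scalar_matrix_convex]). *)

Set Implicit Arguments.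
Unset Strict Implicit.
Unset Printing Implicit Defensive.

Local Open Scope classical_set_scope.
Local Open Scope ring_scope.

(** * Gram matrices and the positive semidefinite order *)

Section gram.
Context {R : realType}.

Lemma mxDE m n (A B : 'M[R]_(m, n)) i j : (A + B) i j = A i j + B i j.
Proof. by rewrite mxE. Qed.

Lemma mxBE m n (A B : 'M[R]_(m, n)) i j : (A - B) i j = A i j - B i j.
Proof. by rewrite !mxE. Qed.

Lemma mxZE m n a (A : 'M[R]_(m, n)) i j : (a *: A) i j = a * A i j.
Proof. by rewrite mxE. Qed.

Lemma sqnormE m (u : 'cV[R]_m) : (u^T *m u) 0 0 = \sum_i u i 0 ^+ 2.
Proof. by rewrite !mxE; apply: eq_bigr => i _; rewrite mxE expr2. Qed.

Lemma sqnorm_ge0 m (u : 'cV[R]_m) : 0 <= (u^T *m u) 0 0.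
Proof. by rewrite sqnormE sumr_ge0// => i _; exact: sqr_ge0. Qed.

Lemma sqnorm_eq0 m (u : 'cV[R]_m) : (u^T *m u) 0 0 = 0 -> u = 0.
Proof.
rewrite sqnormE => /eqP; rewrite psumr_eq0 => [/allP u0|i _]; last exact: sqr_ge0.
apply/colP => i; rewrite mxE; apply/eqP.
by have := u0 i (mem_index_enum _); rewrite /= sqrf_eq0.
Qed.

Lemma sqnorm_trmul m n (A : 'M[R]_(m, n)) (u : 'cV[R]_m) :
  (u^T *m (A *m A^T) *m u) 0 0 = ((A^T *m u)^T *m (A^T *m u)) 0 0.
Proof. by rewrite trmx_mul trmxK !mulmxA. Qed.

Lemma mx_eq0_cV m n (A : 'M[R]_(m, n)) :
  (forall v : 'cV[R]_n, A *m v = 0) -> A = 0.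
Proof.
move=> A0; apply/matrixP => i j; rewrite mxE.
have /colP/(_ i) := A0 (delta_mx j 0).
by rewrite -colE !mxE.
Qed.

Lemma mulmx_tr_eq0 m n (A : 'M[R]_(m, n)) : A *m A^T = 0 -> A = 0.
Proof.
move=> AA; apply: trmx_inj; rewrite trmx0; apply: mx_eq0_cV => v.
by apply: sqnorm_eq0; rewrite -sqnorm_trmul AA mulmx0 mul0mx mxE.
Qed.

(** [N *m N^T] and [N] have the same range because they have the same left
    kernel: [u^T *m (N *m N^T) *m u] is the squared norm of [N^T *m u]. *)
Lemma gram_range m n (N : 'M[R]_(m, n)) : exists W, N *m N^T *m W = N.
Proof.
suff /submxP[D ND] : (N^T <= N *m N^T)%MS.
  by exists D^T; apply: trmx_inj; rewrite trmx_mul trmxK trmx_mul trmxK.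
rewrite submxE; move: (cokermx _) (mulmx_coker (N *m N^T)) => K NK.
apply/eqP/trmx_inj; rewrite trmx0 trmx_mul trmxK; apply: mulmx_tr_eq0.
by rewrite trmx_mul trmxK -mulmxA [N *m _]mulmxA NK mulmx0.
Qed.

Lemma psd_leP d (A B : 'M[R]_d) :
  psd_le A B <-> forall u : 'cV[R]_d, (u^T *m A *m u) 0 0 <= (u^T *m B *m u) 0 0.
Proof.
by split=> AB u; have := AB u; rewrite mulmxBr mulmxBl mxBE subr_ge0.
Qed.

(** Douglas' factorization.  With [W] from [gram_range], [C := W^T *m M] works:
    [N *m W^T] fixes the range of [N], hence that of [M], and [C^T] is [M^T]
    composed with [W], which the hypothesis compares to the orthogonal projection
    [N^T *m W]. *)
Lemma psd_le_factor d q (M N : 'M[R]_(d, q)) :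
  psd_le (M *m M^T) (N *m N^T) ->
  exists2 C : 'M[R]_q, M = N *m C & psd_le (C *m C^T) 1%:M.
Proof.
move=> /psd_leP MN.
have MNt (u : 'cV[R]_d) :
    ((M^T *m u)^T *m (M^T *m u)) 0 0 <= ((N^T *m u)^T *m (N^T *m u)) 0 0.
  by rewrite -!sqnorm_trmul.
have [W NW] := gram_range N.
(* [Pi] is the orthogonal projection on the row space of [N] *)
have [Pi PiD] : exists Pi, Pi = N^T *m W by eexists.
have NPi : N *m Pi = N by rewrite PiD mulmxA.
have PiE : Pi^T *m Pi = Pi^T.
  by rewrite {1 3}PiD trmx_mul trmxK -mulmxA NPi.
have PiT : Pi^T = Pi by rewrite -[RHS]trmxK -PiE trmx_mul trmxK.
have WN : W^T *m N = Pi by rewrite -PiT PiD trmx_mul trmxK.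
exists (W^T *m M).
  apply/eqP; rewrite -subr_eq0 mulmxA -{1}[M]mul1mx -mulmxBl; apply/eqP.
  apply: trmx_inj; rewrite trmx0; apply: mx_eq0_cV => u; apply: sqnorm_eq0.
  apply/eqP; rewrite eq_le sqnorm_ge0 andbT.
  rewrite [_^T *m u](_ : _ = M^T *m ((1%:M - N *m W^T)^T *m u)); last first.
    by rewrite trmx_mul mulmxA.
  apply: le_trans (MNt _) _.
  rewrite [N^T *m _](_ : _ = 0) ?mulmx0 ?mxE// mulmxA -trmx_mul mulmxBl mul1mx.
  by rewrite -mulmxA WN NPi subrr trmx0 mul0mx.
apply/psd_leP => u; rewrite sqnorm_trmul.
rewrite [_^T *m u](_ : _ = M^T *m (W *m u)); last first.
  by rewrite trmx_mul trmxK mulmxA.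
apply: le_trans (MNt _) _.
rewrite [N^T *m _](_ : _ = Pi *m u); last by rewrite PiD mulmxA.
rewrite mulmx1 -subr_ge0.
have [v vE] : exists v, v = Pi *m u by eexists.
have vu : v^T *m u = v^T *m v.
  by rewrite vE trmx_mul -!mulmxA [Pi^T *m (Pi *m u)]mulmxA PiE.
have uv : u^T *m v = v^T *m v.
  by apply: trmx_inj; rewrite !trmx_mul !trmxK.
rewrite -vE -mxBE (_ : u^T *m u - _ = (u - v)^T *m (u - v)) ?sqnorm_ge0//.
have -> : (u - v)^T = u^T - v^T by rewrite linearB.
by rewrite mulmxBl !mulmxBr uv vu subrr subr0.
Qed.

(** The quadratic form of [B] is nonnegative on the span of [x] and [y], so its
    discriminant there is nonpositive; the form may vanish at [y], hence the
    separate case. *)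
Lemma psd_cauchy_schwarz m (B : 'M[R]_m) (x y : 'cV[R]_m) : B^T = B ->
  (forall u : 'cV[R]_m, 0 <= (u^T *m B *m u) 0 0) ->
  ((x^T *m B *m y) 0 0) ^+ 2 <= (x^T *m B *m x) 0 0 * (y^T *m B *m y) 0 0.
Proof.
move=> Bsym Bpsd.
have E s t : ((s *: x + t *: y)^T *m B *m (s *: x + t *: y)) 0 0 =
    s ^+ 2 * (x^T *m B *m x) 0 0 + 2 * s * t * (x^T *m B *m y) 0 0
    + t ^+ 2 * (y^T *m B *m y) 0 0.
  have yx : (y^T *m B *m x) 0 0 = (x^T *m B *m y) 0 0.
    rewrite (_ : x^T *m B *m y = (y^T *m B *m x)^T) ?mxE//.
    by rewrite !trmx_mul Bsym trmxK mulmxA.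
  have -> : (s *: x + t *: y)^T = s *: x^T + t *: y^T.
    by rewrite linearD/= !linearZ.
  rewrite !mulmxDl !mulmxDr -!scalemxAl -!scalemxAr.
  by rewrite !(mxDE, mxZE) yx; ring.
set X := (x^T *m B *m x) 0 0 in E *; set Y := (y^T *m B *m y) 0 0 in E *.
set c := (x^T *m B *m y) 0 0 in E *.
have Y0 : 0 <= Y by exact: Bpsd.
have [Yeq0|Yneq0] := eqVneq Y 0.
  have [->|c0] := eqVneq c 0; first by rewrite expr0n/= Yeq0 mulr0.
  have := Bpsd (1 *: x + (- (X + 1) / (2 * c)) *: y).
  rewrite E Yeq0 [X in 0 <= X](_ : _ = -1) ?lerN10//; last by field.
  by rewrite ler0N1.
have Ygt0 : 0 < Y by rewrite lt_neqAle eq_sym Yneq0.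
have := Bpsd (Y *: x + (- c) *: y); rewrite E.
rewrite [X in 0 <= X](_ : _ = Y * (X * Y - c ^+ 2)); last by ring.
by rewrite pmulr_rge0// subr_ge0.
Qed.

End gram.

(** * Contractions that are not orthogonal are not extreme points *)

Section contractions.
Context {R : realType} {q : nat}.
Implicit Types C E O : 'M[R]_q.

Lemma contractionP C : psd_le (C *m C^T) 1%:M <-> forall v : 'cV[R]_q,
  ((C^T *m v)^T *m (C^T *m v)) 0 0 <= (v^T *m v) 0 0.
Proof.
split=> [/psd_leP CP v|CP].
  by have := CP v; rewrite sqnorm_trmul mulmx1.
by apply/psd_leP => v; rewrite sqnorm_trmul mulmx1; exact: CP.
Qed.

Lemma trmx_add m n (A B : 'M[R]_(m, n)) : (A + B)^T = A^T + B^T.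
Proof. by rewrite linearD. Qed.

Lemma trmx_scale m n k (A : 'M[R]_(m, n)) : (k *: A)^T = k *: A^T.
Proof. by rewrite linearZ. Qed.

Lemma sqnormD m (x u : 'cV[R]_m) (k : R) :
  ((x + k *: u)^T *m (x + k *: u)) 0 0 =
  (x^T *m x) 0 0 + 2 * k * (u^T *m x) 0 0 + k ^+ 2 * (u^T *m u) 0 0.
Proof.
have xu : (x^T *m u) 0 0 = (u^T *m x) 0 0.
  have -> : x^T *m u = (u^T *m x)^T by rewrite trmx_mul trmxK.
  by rewrite [LHS]mxE.
rewrite trmx_add trmx_scale mulmxDl !mulmxDr.
rewrite -!scalemxAl -!scalemxAr !(mxDE, mxZE) xu.
by ring.
Qed.

Lemma mx_neq0_col m n (A : 'M[R]_(m, n)) : A != 0 ->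
  exists j, A *m delta_mx j (0 : 'I_1) != 0.
Proof.
move=> A0; have [/existsP//|/existsPn Aj] :=
  boolP [exists j, A *m delta_mx j (0 : 'I_1) != 0].
case/eqP: A0; apply/matrixP => i j; have := Aj j.
by rewrite negbK -colE => /eqP/colP/(_ i); rewrite !mxE.
Qed.

(** With [B := 1 - C *m C^T] and [B' := 1 - C^T *m C], which satisfy
    [C *m B' = B *m C], the direction [E = (B *m b) *m (B' *m a)^T] is harmless:
    for [w := B *m b] and [u := B' *m a], the increments of the squared norm of
    [(C + s *: E)^T *m v] are quadratic in [w^T *m v] and [(C *m u)^T *m v], both
    of which the Cauchy-Schwarz inequality for [B] bounds by the slack
    [v^T *m B *m v]. *)
Lemma contraction_perturb C : psd_le (C *m C^T) 1%:M -> ~ orthogonal_mx C ->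
  exists2 E, E != 0 & forall s, `|s| <= 1 ->
    psd_le ((C + s *: E) *m (C + s *: E)^T) 1%:M.
Proof.
move=> /contractionP CP CO.
pose B := 1%:M - C *m C^T; pose B' := 1%:M - C^T *m C.
have CB' : C *m B' = B *m C.
  by rewrite /B /B' mulmxBr mulmxBl mulmx1 mul1mx mulmxA.
have Bsym : B^T = B by rewrite /B linearB/= trmx1 trmx_mul trmxK.
have BE (v : 'cV[R]_q) :
    (v^T *m B *m v) 0 0 = (v^T *m v) 0 0 - ((C^T *m v)^T *m (C^T *m v)) 0 0.
  by rewrite /B mulmxBr mulmx1 mulmxBl mxBE sqnorm_trmul.
have Bpsd (v : 'cV[R]_q) : 0 <= (v^T *m B *m v) 0 0 by rewrite BE subr_ge0.
have /mx_neq0_col[i wi] : B != 0.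
  by apply/eqP => /eqP; rewrite subr_eq0 eq_sym => /eqP; exact: CO.
have /mx_neq0_col[j uj] : B' != 0.
  by apply/eqP => /eqP; rewrite subr_eq0 eq_sym => /eqP /mulmx1C.
set b := delta_mx i _ in wi; set a := delta_mx j _ in uj.
set w := B *m b in wi; set u := B' *m a in uj.
pose al := ((C *m a)^T *m B *m (C *m a)) 0 0.
pose be := (b^T *m B *m b) 0 0.
pose c := (u^T *m u) 0 0.
have al0 : 0 <= al by exact: Bpsd.
have be0 : 0 <= be by exact: Bpsd.
have c0 : 0 <= c by exact: sqnorm_ge0.
(* [e] is small enough for the linear and the quadratic terms together to stay
   below the slack *)
pose e := (1 + al + be + be * c)^-1.
have den0 : 0 < 1 + al + be + be * c.
  by rewrite ltr_wpDr ?mulr_ge0// ltr_wpDr// ltr_wpDr.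
have e0 : 0 < e by rewrite invr_gt0.
have e1 : e * (1 + al + be + be * c) = 1 by rewrite mulVf// gt_eqF.
exists (e *: (w *m u^T)).
  rewrite scaler_eq0 gt_eqF//=; apply/eqP => /(congr1 (fun M => M *m u)).
  rewrite mul0mx -mulmxA [u^T *m u]mx11_scalar mul_mx_scalar => /eqP.
  rewrite scaler_eq0 (negbTE wi) orbF => /eqP /sqnorm_eq0 u0.
  by rewrite u0 eqxx in uj.
move=> s s1; apply/contractionP => v.
set x := C^T *m v; pose p := (b^T *m B *m v) 0 0.
pose r := ((C *m a)^T *m B *m v) 0 0.
have wv : w^T *m v = p%:M by rewrite [LHS]mx11_scalar /p /w trmx_mul Bsym.
have ux : (u^T *m x) 0 0 = r.
  rewrite /r /x [_^T *m B](_ : _ = (B *m (C *m a))^T); last first.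
    by rewrite [RHS]trmx_mul Bsym.
  rewrite [B *m (C *m a)](_ : _ = C *m u); last by rewrite /u !mulmxA CB'.
  by rewrite [(C *m u)^T]trmx_mul mulmxA.
have -> : (C + s *: (e *: (w *m u^T)))^T *m v = x + (s * e * p) *: u.
  rewrite scalerA trmx_add trmx_scale mulmxDl.
  congr (_ + _); rewrite trmx_mul trmxK -scalemxAl -mulmxA wv mul_mx_scalar.
  by rewrite scalerA.
rewrite sqnormD ux -/c; pose bv := (v^T *m B *m v) 0 0.
have bvE : bv = (v^T *m v) 0 0 - (x^T *m x) 0 0 by exact: BE.
have p2 : p ^+ 2 <= be * bv by exact: psd_cauchy_schwarz.
have r2 : r ^+ 2 <= al * bv by exact: psd_cauchy_schwarz.
have bv0 : 0 <= bv by exact: Bpsd.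
have e_le1 : e <= 1.
  by rewrite invf_le1// -!addrA lerDl !addr_ge0// mulr_ge0.
have s2 : s ^+ 2 <= 1 by rewrite -real_normK ?num_real// expr_le1.
have pr : 2 * s * p * r <= p ^+ 2 + r ^+ 2.
  have : 0 <= (p - s * r) ^+ 2 by exact: sqr_ge0.
  have : 0 <= (1 - s ^+ 2) * r ^+ 2 by rewrite mulr_ge0 ?subr_ge0 ?sqr_ge0.
  by nra.
have cross : e * (2 * s * p * r) <= e * ((be + al) * bv).
  by rewrite ler_wpM2l ?(ltW e0)//; lra.
have quad : (s * e * p) ^+ 2 * c <= e * (be * c * bv).
  have -> : (s * e * p) ^+ 2 * c = s ^+ 2 * (e * (e * (p ^+ 2 * c))) by ring.
  have pc0 : 0 <= p ^+ 2 * c by rewrite mulr_ge0 ?sqr_ge0.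
  apply: (@le_trans _ _ (e * (p ^+ 2 * c))).
    apply: (@le_trans _ _ (e * (e * (p ^+ 2 * c)))).
      by rewrite ler_piMl// (mulr_ge0 (ltW e0))// (mulr_ge0 (ltW e0)).
    by rewrite ler_piMl// (mulr_ge0 (ltW e0)).
  rewrite ler_wpM2l ?(ltW e0)// (mulrAC be); apply: ler_wpM2r => //.
have eE : e * ((be + al) * bv) + e * (be * c * bv) <= bv.
  have ebv0 : 0 <= e * bv by rewrite mulr_ge0// ltW.
  have : e * (1 + al + be + be * c) * bv = bv by rewrite e1 mul1r.
  by lra.
have : 2 * (s * e * p) * r = e * (2 * s * p * r) by ring.
by lra.
Qed.

End contractions.

(** * Lipschitz convex functions *)

Section convex_lipschitz.
Context {R : realType}.

Definition cvx_fun (E : lmodType R) (f : E -> R) := forall (x y : E) (a : R),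
  0 <= a <= 1 -> f (a *: x + (1 - a) *: y) <= a * f x + (1 - a) * f y.

Definition cvx_lip (V : normedModType R) (f : V -> R) :=
  cvx_fun f /\ exists2 K, 0 <= K & forall x y, `|f x - f y| <= K * `|x - y|.

Lemma convex_functionP (E : lmodType R) (f : E -> R) :
  convex_function [set: convex_lmodType E] f <-> cvx_fun f.
Proof.
split=> [cf x y a /andP[a0 a1]|cf t x y _ _].
  by have := cf (Itv01 a0 a1) x y; rewrite !inE; apply.
by apply: cf; rewrite ge0/= le1.
Qed.

(** Along the ray from [y] through [x], convexity bounds the slope between [y] and
    [x] by the slope between [y] and points arbitrarily far away, which linear
    growth bounds by [K]. *)
Lemma cvx_lip_growth (V : normedModType R) (f : V -> R) (K : R) :
  cvx_fun f -> (forall x, f x <= K * (1 + `|x|)) -> cvx_lip f.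
Proof.
move=> cf fK; split=> //; exists `|K| => // x0 y0.
suff H x y : f x - f y <= `|K| * `|x - y|.
  by rewrite ler_norml H lerNl opprB distrC H.
apply/ler_addgt0Pr => e e0.
pose c := `|K| * (1 + `|y|) - f y.
(* [x] lies on the segment from [y] to the far point [y + t *: (x - y)] *)
pose t := 1 + `|c| / e.
have t1 : 1 <= t by rewrite lerDl divr_ge0// ltW.
have t0 : 0 < t by apply: lt_le_trans t1.
have xE : x = t^-1 *: (y + t *: (x - y)) + (1 - t^-1) *: y.
  rewrite scalerDr scalerA mulVf ?gt_eqF// scale1r scalerBl scale1r.
  by rewrite addrA addrAC [_ *: y + _]addrC addrK subrK.
have tV : 0 <= t^-1 <= 1 by rewrite invr_ge0 ltW//= invf_le1.
have := cf (y + t *: (x - y)) y _ tV; rewrite -xE => fx.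
have far : f (y + t *: (x - y)) <= `|K| * (1 + `|y|) + t * (`|K| * `|x - y|).
  apply: (le_trans (fK _)).
  apply: (@le_trans _ _ (`|K| * (1 + `|y + t *: (x - y)|))).
    by rewrite ler_wpM2r ?ler_norm// addr_ge0.
  rewrite mulrCA -mulrDr ler_wpM2l// -addrA lerD2l.
  by rewrite (le_trans (ler_normD _ _))// normrZ gtr0_norm.
have {}fx : f x - f y <= t^-1 * c + `|K| * `|x - y|.
  have : t^-1 * f (y + t *: (x - y)) <=
      t^-1 * (`|K| * (1 + `|y|) + t * (`|K| * `|x - y|)).
    by rewrite ler_wpM2l// invr_ge0 ltW.
  rewrite [leRHS]mulrDr mulKf ?gt_eqF// => far'.
  have := le_trans fx (lerD far' (lexx _)).
  by rewrite /c; nra.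
apply: (le_trans fx); rewrite addrC lerD2l ler_pdivrMl//.
apply: (le_trans (ler_norm _)); rewrite /t mulrDl mul1r mulfVK ?gt_eqF//.
by rewrite lerDr ltW.
Qed.

Lemma cvx_lip_continuous (V : normedModType R) (f : V -> R) :
  cvx_lip f -> continuous f.
Proof.
move=> [_ [K K0 fK]] x; apply/cvgrPdist_le => e e0.
near=> y; apply: (le_trans (fK _ _)).
rewrite (@le_trans _ _ ((K + 1) * `|x - y|))//.
  by rewrite ler_wpM2r// lerDl.
rewrite -ler_pdivlMl ?ltr_wpDl//.
near: y; apply: cvgr_dist_le; first exact: cvg_id.
by rewrite mulr_gt0 ?invr_gt0 ?ltr_wpDl.
Unshelve. all: by end_near. Qed.

Lemma cvx_lip_bound (V : normedModType R) (f : V -> R) : cvx_lip f ->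
  exists2 K, 0 <= K & forall x, `|f x| <= K * (1 + `|x|).
Proof.
move=> [_ [K K0 fK]]; exists (`|f 0| + K); first exact: addr_ge0.
move=> x; have := fK x 0; rewrite subr0 => fx.
rewrite -[f x](subrK (f 0)) (le_trans (ler_normD _ _))//.
have := normr_ge0 (f 0); have := normr_ge0 x; nra.
Qed.

End convex_lipschitz.

Section matrix_norm.
Context {R : realType} {m n : nat}.
Implicit Types (v : 'M[R]_(m, n)).

Lemma entry_le_norm v i j : `|v i j| <= `|v|.
Proof.
rewrite [leRHS]/Num.Def.normr/= mx_normrE; apply/bigmax_geP; right => /=.
by exists (i, j).
Qed.

Lemma norm_le_sum v : `|v| <= \sum_i \sum_j `|v i j|.
Proof.
rewrite [leLHS]/Num.Def.normr/= mx_normrE; apply/bigmax_leP; split.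
  by rewrite sumr_ge0// => i _; rewrite sumr_ge0.
move=> [i j] _ /=; rewrite (bigD1 i)//= (bigD1 j)//= -addrA lerDl.
by rewrite addr_ge0// sumr_ge0// => k _; rewrite ?sumr_ge0.
Qed.

End matrix_norm.

Section subgradient.
Context {R : realType} {m n : nat}.
Implicit Types (v G : 'M[R]_(m, n)).

Definition mxdot G v : R := \sum_i \sum_j G i j * v i j.

Lemma mxdotDr G v w : mxdot G (v + w) = mxdot G v + mxdot G w.
Proof.
rewrite -big_split; apply: eq_bigr => i _; rewrite -big_split.
by apply: eq_bigr => j _; rewrite mxE mulrDr.
Qed.

Lemma mxdotZr G a v : mxdot G (a *: v) = a * mxdot G v.
Proof.
rewrite mulr_sumr; apply: eq_bigr => i _; rewrite mulr_sumr.
by apply: eq_bigr => j _; rewrite mxE mulrCA.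
Qed.

Lemma mxdot0r G : mxdot G 0 = 0.
Proof. by rewrite -[0](scale0r 0) mxdotZr mul0r. Qed.

Lemma mxdotBr G v w : mxdot G (v - w) = mxdot G v - mxdot G w.
Proof. by rewrite mxdotDr -scaleN1r mxdotZr mulN1r. Qed.

Lemma mxdot_delta G i j : mxdot G (delta_mx i j) = G i j.
Proof.
rewrite /mxdot (bigD1 i)//= (bigD1 j)//= mxE !eqxx mulr1.
rewrite big1 ?addr0 => [|k kj]; last by rewrite mxE (negbTE kj) andbF mulr0.
rewrite big1 ?addr0// => k ki; rewrite big1// => l _.
by rewrite mxE (negbTE ki) mulr0.
Qed.

Lemma mxdot_le (N : R) G v : (forall i j, `|G i j| <= N) ->
  `|mxdot G v| <= (N * m%:R * n%:R) * `|v|.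
Proof.
move=> GN; apply: (le_trans (ler_norm_sum _ _ _)).
apply: (@le_trans _ _ (\sum_(i < m) (N * n%:R * `|v|))); last first.
  rewrite sumr_const card_ord -[leLHS]mulr_natl.
  by rewrite le_eqVlt; apply/orP; left; apply/eqP; ring.
apply: ler_sum => i _; apply: (le_trans (ler_norm_sum _ _ _)).
apply: (@le_trans _ _ (\sum_(j < n) (N * `|v|))); last first.
  rewrite sumr_const card_ord -[leLHS]mulr_natl.
  by rewrite le_eqVlt; apply/orP; left; apply/eqP; ring.
by apply: ler_sum => j _; rewrite normrM ler_pM// entry_le_norm.
Qed.

(** The one-dimensional extension step of the Hahn-Banach theorem: [c] is the
    supremum of the lower bounds imposed by negative [t], and convexity of [p]
    makes each of them at most each upper bound imposed by positive [t]. *)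
Lemma linear_minorant_step (p : 'M[R]_(m, n) -> R) (F : set 'M[R]_(m, n)) G e :
  cvx_fun p -> F 0 -> (forall a b v w, F v -> F w -> F (a *: v + b *: w)) ->
  (forall v, F v -> mxdot G v <= p v) ->
  exists c, forall v t, F v -> mxdot G v + t * c <= p (v + t *: e).
Proof.
move=> cp F0 FD Gp.
pose L := [set r | exists v s, [/\ F v, 0 < s &
  r = (mxdot G v - p (v - s *: e)) / s]].
have LU w t : F w -> 0 < t -> ubound L ((p (w + t *: e) - mxdot G w) / t).
  move=> Fw t0 _ [v [s [Fv s0 ->]]].
  rewrite ler_pdivrMr// mulrAC ler_pdivlMr//.
  have st0 : 0 < s + t by rewrite addr_gt0.
  pose a := s / (s + t).
  have aE : 1 - a = t / (s + t) by rewrite /a; field; rewrite gt_eqF.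
  have a01 : 0 <= a <= 1.
    by rewrite divr_ge0 ?(ltW s0) ?(ltW st0)//= /a ler_pdivrMr// mul1r lerDl ltW.
  have := cp (w + t *: e) (v - s *: e) _ a01.
  have -> : a *: (w + t *: e) + (1 - a) *: (v - s *: e) =
      a *: w + (1 - a) *: v.
    rewrite !scalerDr scalerN !scalerA addrACA [X in _ + X](_ : _ = 0) ?addr0//.
    rewrite aE -scalerBl [X in X *: _](_ : _ = 0) ?scale0r//.
    by rewrite /a; field; rewrite gt_eqF.
  move/(le_trans (Gp _ (FD _ _ _ _ Fw Fv))).
  rewrite mxdotDr !mxdotZr aE /a !(mulrAC _ _^-1) -!mulrDl.
  by rewrite ler_pM2r ?invr_gt0//; nra.
have Lsup : has_sup L.
  split; first by exists ((mxdot G 0 - p (0 - 1 *: e)) / 1); exists 0, 1.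
  by exists ((p (0 + 1 *: e) - mxdot G 0) / 1); apply: LU.
exists (sup L) => v t Fv.
have [t0|t0|->] := ltgtP t 0; last by rewrite mul0r scale0r !addr0; exact: Gp.
- have : (mxdot G v - p (v - (- t) *: e)) / (- t) <= sup L.
    by apply: sup_upper_bound => //; exists v, (- t); rewrite oppr_gt0.
  by rewrite ler_pdivrMr ?oppr_gt0// scaleNr opprK; nra.
- have : sup L <= (p (v + t *: e) - mxdot G v) / t.
    by apply: ge_sup; [exact: Lsup.1|exact: LU].
  by rewrite ler_pdivlMr//; nra.
Qed.

(** Hahn-Banach in finite dimension: the subspace on which [mxdot G] is below [p]
    grows by one matrix entry at a time. *)
Lemma linear_minorant (p : 'M[R]_(m, n) -> R) : cvx_fun p -> 0 <= p 0 ->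
  exists G, forall v, mxdot G v <= p v.
Proof.
move=> cp p0.
suff [G GP] : exists G, forall v, (forall i j,
    (i, j) \notin enum {: 'I_m * 'I_n} -> v i j = 0) -> mxdot G v <= p v.
  by exists G => v; apply: GP => i j; rewrite mem_enum.
elim: (enum _) => [|[i0 j0] s [G GP]].
  exists 0 => v v0; have -> : v = 0 by apply/matrixP => i j; rewrite v0// mxE.
  by rewrite mxdot0r.
pose F v := forall i j, (i, j) \notin s -> v i j = 0.
have [||c cP] := @linear_minorant_step p F G (delta_mx i0 j0) cp _ _ GP.
- by move=> i j _; rewrite mxE.
- by move=> a b v w Fv Fw i j ijs; rewrite !mxE Fv// Fw// !mulr0 addr0.
exists (G + (c - G i0 j0) *: delta_mx i0 j0) => v Fv.
pose v' := v - v i0 j0 *: delta_mx i0 j0.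
have Fv' : F v'.
  move=> i j ijs; rewrite !mxE.
  have [/eqP[-> ->]|ij0] := boolP ((i, j) == (i0, j0)).
    by rewrite !eqxx mulr1 subrr.
  rewrite [v i j]Fv ?inE ?negb_or ?ij0//.
  by move: ij0; rewrite xpair_eqE => /negbTE ->; rewrite mulr0 subr0.
have vE : v = v' + v i0 j0 *: delta_mx i0 j0 by rewrite subrK.
rewrite [in leRHS]vE; apply: le_trans (cP _ _ Fv').
rewrite le_eqVlt; apply/orP; left; apply/eqP.
have -> : mxdot (G + (c - G i0 j0) *: delta_mx i0 j0) v =
    mxdot G v + (c - G i0 j0) * v i0 j0.
  rewrite -[in RHS](mxdot_delta v i0 j0) mulr_sumr -big_split.
  apply: eq_bigr => i _; rewrite mulr_sumr -big_split; apply: eq_bigr => j _.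
  by rewrite !mxE/=; ring.
by rewrite mxdotBr mxdotZr mxdot_delta; ring.
Qed.

Lemma subgradient (phi : 'M[R]_(m, n) -> R) x : cvx_fun phi ->
  exists G, forall y, phi x + mxdot G (y - x) <= phi y.
Proof.
move=> cphi; have [||G GP] := @linear_minorant (fun v => phi (x + v) - phi x).
- move=> v w a a01.
  have -> : x + (a *: v + (1 - a) *: w) = a *: (x + v) + (1 - a) *: (x + w).
    by rewrite !scalerDr addrACA -scalerDl [a + _]addrC subrK scale1r.
  by have := cphi (x + v) (x + w) a a01; lra.
- by rewrite addr0 subrr.
by exists G => y; have /= := GP (y - x); rewrite [x + _]addrC subrK; lra.
Qed.

End subgradient.

Section affine_approximation.
Context {R : realType} {m n : nat}.
Variable phi : 'M[R]_(m, n) -> R.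
Hypothesis cphi : cvx_fun phi.

Let aff (N : R) (x : 'M[R]_(m, n)) : set R := [set r | exists b G,
  [/\ forall y, b + mxdot G y <= phi y, forall i j, `|G i j| <= N &
      r = b + mxdot G x]].

Let aff_le N x r : aff N x r -> r <= phi x.
Proof. by move=> [b [G [+ _ ->]]]; apply. Qed.

Let aff_grad x (G : 'M[R]_(m, n)) N :
  (forall y, phi x + mxdot G (y - x) <= phi y) ->
  (forall i j, `|G i j| <= N) -> aff N x (phi x).
Proof.
move=> Gx GN; exists (phi x - mxdot G x), G; split=> //; last by rewrite subrK.
by move=> y; have := Gx y; rewrite mxdotBr; lra.
Qed.

Let entry_bound (G : 'M[R]_(m, n)) : exists N : nat, forall i j, `|G i j| <= N%:R.
Proof.
exists (Num.truncn `|G|).+1 => i j; apply: (le_trans (entry_le_norm _ _ _)).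
exact/ltW/truncnS_gt.
Qed.

(** [f k] is the supremum of the affine minorants of [phi] whose coefficients are
    bounded by [N0 + k], where [N0] is large enough for one such minorant to
    exist.  It reaches [phi x] as soon as a subgradient at [x] is allowed. *)
Lemma cvx_approx : exists f : nat -> 'M[R]_(m, n) -> R,
  [/\ forall k, cvx_lip (f k), forall k x, f k x <= f k.+1 x,
      forall k x, f k x <= phi x & forall x, exists k, f k x = phi x].
Proof.
have [G0 G0P] := subgradient 0 cphi; have [N0 N0P] := entry_bound G0.
have ne N x : N0%:R <= N -> aff N x !=set0.
  move=> N0N; exists (phi 0 + mxdot G0 x), (phi 0), G0; split=> //.
    by move=> y; have := G0P y; rewrite subr0.
  by move=> i j; apply: le_trans (N0P i j) N0N.
have sup_ N x : N0%:R <= N -> has_sup (aff N x).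
  by move=> N0N; split; [exact: ne|]; exists (phi x) => r; exact: aff_le.
have N0k k : N0%:R <= (N0 + k)%:R :> R by rewrite ler_nat leq_addr.
exists (fun k x => sup (aff (N0 + k)%:R x)); split.
- move=> k; split=> [x y a /andP[a0 a1]|].
    apply: ge_sup; first exact: ne.
    move=> _ [b [G [Gphi GN ->]]].
    rewrite mxdotDr !mxdotZr [leLHS](_ : _ =
      a * (b + mxdot G x) + (1 - a) * (b + mxdot G y)); last by ring.
    apply: lerD; apply: ler_wpM2l; rewrite ?subr_ge0//.
      by apply: sup_upper_bound; [exact: sup_|exists b, G].
    by apply: sup_upper_bound; [exact: sup_|exists b, G].
  exists ((N0 + k)%:R * m%:R * n%:R); first by rewrite !mulr_ge0.
  move=> x0 y0; suff H x y : sup (aff (N0 + k)%:R x) - sup (aff (N0 + k)%:R y) <=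
      ((N0 + k)%:R * m%:R * n%:R) * `|x - y|.
    by rewrite ler_norml H lerNl opprB distrC H.
  rewrite lerBlDr; apply: ge_sup; first exact: ne.
  move=> _ [b [G [Gphi GN ->]]].
  have -> : b + mxdot G x = mxdot G (x - y) + (b + mxdot G y).
    by rewrite mxdotBr; ring.
  apply: lerD; first by rewrite (le_trans (ler_norm _))// mxdot_le.
  by apply: sup_upper_bound; [exact: sup_|exists b, G].
- move=> k x; apply: ge_sup; first exact: ne.
  move=> _ [b [G [Gphi GN ->]]]; apply: sup_upper_bound; first exact: sup_.
  exists b, G; split=> // i j; apply: (le_trans (GN i j)).
  by rewrite ler_nat leq_add2l.
- by move=> k x; apply: ge_sup; [exact: ne|move=> r; exact: aff_le].
- move=> x; have [G GP] := subgradient x cphi; have [N NP] := entry_bound G.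
  exists N; apply/eqP; rewrite eq_le; apply/andP; split.
    by apply: ge_sup; [exact: ne|move=> r; exact: aff_le].
  apply: sup_upper_bound; first exact: sup_.
  apply: (aff_grad GP) => i j; apply: le_trans (NP i j) _.
  by rewrite ler_nat leq_addl.
Qed.

End affine_approximation.

(** * Maximum of a convex function over contractions *)

Lemma continuous_sumR (R : realType) (U : topologicalType) I (r : seq I)
    (F : I -> U -> R) : (forall i, continuous (F i)) ->
  continuous (fun x => \sum_(i <- r) F i x).
Proof.
move=> cF; elim: r => [|i r IH].
  by under eq_fun do rewrite big_nil; exact: cst_continuous.
under eq_fun do rewrite big_cons.
by move=> x; apply: continuousD; [exact: cF|exact: IH].
Qed.

Section contraction_maximum.
Context {R : realType} {q : nat}.
Implicit Types C E O : 'M[R]_q.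

Definition frob2 C : R := \sum_i \sum_j C i j ^+ 2.

Lemma frob2_perturb C E :
  frob2 (C + E) + frob2 (C - E) = 2 * frob2 C + 2 * frob2 E.
Proof.
rewrite /frob2 !mulr_sumr -!big_split; apply: eq_bigr => i _ /=.
rewrite !mulr_sumr -!big_split; apply: eq_bigr => j _ /=.
by rewrite !mxE; ring.
Qed.

Lemma frob2_ge0 C : 0 <= frob2 C.
Proof. by apply: sumr_ge0 => i _; apply: sumr_ge0 => j _; exact: sqr_ge0. Qed.

Lemma frob2_gt0 E : E != 0 -> 0 < frob2 E.
Proof.
rewrite lt_neqAle frob2_ge0 andbT; apply: contra_neq => /esym/eqP.
rewrite /frob2 psumr_eq0 => [/allP E0|i _]; last first.
  by apply: sumr_ge0 => j _; exact: sqr_ge0.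
apply/matrixP => i j; rewrite mxE; apply/eqP; rewrite -sqrf_eq0.
have := E0 i (mem_index_enum _); rewrite /= psumr_eq0 => [/allP Ei|k _].
  exact: (Ei j (mem_index_enum _)).
exact: sqr_ge0.
Qed.

Lemma contraction_row C i : psd_le (C *m C^T) 1%:M -> \sum_j C i j ^+ 2 <= 1.
Proof.
move/contractionP/(_ (delta_mx i 0)); rewrite !sqnormE -colE.
under eq_bigr do rewrite !mxE; rewrite [leRHS](bigD1 i)//= !mxE !eqxx expr1n.
by rewrite [X in 1 + X]big1 ?addr0// => k ki; rewrite mxE (negbTE ki) expr0n.
Qed.

Lemma contraction_frob2 C : psd_le (C *m C^T) 1%:M -> frob2 C <= q%:R.
Proof.
move=> CP; apply: (@le_trans _ _ (\sum_(i < q) 1)).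
  by apply: ler_sum => i _; exact: contraction_row.
by rewrite sumr_const card_ord.
Qed.

Lemma contraction_entry C i j : psd_le (C *m C^T) 1%:M -> `|C i j| <= 1.
Proof.
move=> /(contraction_row i); rewrite (bigD1 j)//= => Ci.
rewrite -(@expr_le1 _ 2)// real_normK ?num_real//; apply: le_trans Ci.
by rewrite lerDl sumr_ge0// => k _; exact: sqr_ge0.
Qed.

Let vec_mxE (v : 'rV[R]_(q * q)) i j : (vec_mx v) i j = v 0 (mxvec_index i j).
Proof. by rewrite mxE. Qed.

Let entry_continuous i j : continuous (fun v : 'rV[R]_(q * q) => (vec_mx v) i j).
Proof. by under eq_fun do rewrite vec_mxE; exact: coord_continuous. Qed.

(** Closedness: being a contraction is an intersection, over test vectors, of
    closed conditions that are polynomial in the entries. *)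
Lemma contractions_compact :
  compact [set v : 'rV[R]_(q * q) | psd_le (vec_mx v *m (vec_mx v)^T) 1%:M].
Proof.
apply: bounded_closed_compact.
  exists 1; split=> // y y1 v /= vP; apply: le_trans (ltW y1).
  rewrite [leLHS]/Num.Def.normr/= mx_normrE; apply/bigmax_leP; split => //=.
  move=> [i k] _ /=; rewrite ord1; case/mxvec_indexP: k => {}i j.
  by rewrite -vec_mxE; exact: contraction_entry.
rewrite (_ : mkset _ = \bigcap_(u in [set: 'cV[R]_q])
  ((fun v => (((vec_mx v)^T *m u)^T *m ((vec_mx v)^T *m u)) 0 0) @^-1`
   [set x | x <= (u^T *m u) 0 0])); last first.
  apply/seteqP; split=> [v /= /contractionP vP u _ /=|v vP /=]; first exact: vP.
  by apply/contractionP => u; exact: vP.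
apply: closed_bigI => u _; move: (@closed_le R ((u^T *m u) 0 0)).
move: (mkset _); apply/continuous_closedP; under eq_fun do rewrite sqnormE.
apply: continuous_sumR => j.
suff cj : continuous (fun v : 'rV[R]_(q * q) => ((vec_mx v)^T *m u) j 0).
  by move=> v; apply: continuousM; exact: cj.
under eq_fun do rewrite mxE; apply: continuous_sumR => i.
suff ct : continuous (fun v : 'rV[R]_(q * q) => (vec_mx v)^T j i).
  by move=> v; apply: continuousM; [exact: ct|exact: cst_continuous].
by under eq_fun do rewrite mxE; exact: entry_continuous.
Qed.

Lemma cvx_lip_vec_mx (G : 'M[R]_q -> R) : cvx_lip G ->
  cvx_lip (fun v : 'rV[R]_(q * q) => G (vec_mx v)).
Proof.
move=> [cG [K K0 GK]]; split=> [v w a a01|].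
  by rewrite linearD/= !linearZ/=; exact: cG.
exists K => // v w; apply: (le_trans (GK _ _)); rewrite ler_wpM2l//.
rewrite -linearB/= [leLHS]/Num.Def.normr/= mx_normrE; apply/bigmax_leP.
by split => //= -[i j] _ /=; rewrite vec_mxE entry_le_norm.
Qed.

(** Maximise [G] plus a small multiple of the squared Frobenius norm over the
    compact set of contractions.  A maximiser that is not orthogonal is the
    midpoint of two contractions by [contraction_perturb], which the strict
    convexity of the penalty forbids. *)
Lemma contraction_max (G : 'M[R]_q -> R) (g : R) : cvx_lip G ->
  (forall O, orthogonal_mx O -> G O <= g) ->
  forall C, psd_le (C *m C^T) 1%:M -> G C <= g.
Proof.
move=> cG Gg C0 C0P.
suff H (e : R) : 0 < e -> G C0 <= g + e by apply/ler_addgt0Pr.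
move=> e0.
pose d := e / (q.+1)%:R; have d0 : 0 < d by rewrite divr_gt0.
pose f C := G C + d * frob2 C.
have fcont : continuous (fun v : 'rV[R]_(q * q) => f (vec_mx v)).
  have cG' := cvx_lip_continuous (cvx_lip_vec_mx cG).
  have cfrob : continuous (fun v : 'rV[R]_(q * q) => frob2 (vec_mx v)).
    apply: continuous_sumR => i; apply: continuous_sumR => j v.
    by apply: continuousM; exact: entry_continuous.
  by move=> v; exact: (cvgD (cG' v) (cvgM (cvg_cst d) (cfrob v))).
have [||v /set_mem/= vP vmax] := compact_EVT_max _ contractions_compact
    (f := fun v : 'rV[R]_(q * q) => f (vec_mx v)).
- by exists (mxvec C0); rewrite /= mxvecK.
- by apply: continuous_subspaceT.
have {}vmax C : psd_le (C *m C^T) 1%:M -> f C <= f (vec_mx v).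
  move=> CP; have := vmax (mxvec C); rewrite mxvecK; apply.
  by apply/mem_set; rewrite /= mxvecK.
move: (vec_mx v) vP vmax => C CP Cmax {v}.
have [CO|CnO] := pselect (orthogonal_mx C).
  have f0 : d * frob2 C0 >= 0 by rewrite mulr_ge0 ?frob2_ge0// ltW.
  have fC : d * frob2 C <= e.
    apply: (@le_trans _ _ (d * q.+1%:R)); last by rewrite mulfVK.
    rewrite ler_wpM2l ?(ltW d0)// (le_trans (contraction_frob2 CP))//.
    by rewrite ler_nat.
  by have := Cmax _ C0P; have := Gg _ CO; rewrite /f; lra.
have [E /frob2_gt0 E0 EP] := contraction_perturb CP CnO.
have p1 := Cmax _ (EP 1 (ltac:(by rewrite normr1))).
have n1 := Cmax _ (EP (-1) (ltac:(by rewrite normrN1))).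
rewrite scale1r scaleN1r in p1 n1.
have half : 0 <= (2^-1 : R) <= 1 by lra.
have := cG.1 (C + E) (C - E) _ half.
have -> : 2^-1 *: (C + E) + (1 - 2^-1) *: (C - E) = C.
  by apply/matrixP => i j; rewrite !mxE; field.
have := frob2_perturb C E.
have : 0 < d * frob2 E by rewrite mulr_gt0.
by move: p1 n1; rewrite /f; nra.
Qed.

End contraction_maximum.

(** * Random matrices: measurability, integrability, independence *)

Section measurable_matrix.
Context {R : realType} {dT : measure_display} {T : measurableType dT}.

Lemma continuous_mx_measurable m n (f : 'M[R]_(m, n) -> R) :
  continuous f -> measurable_fun setT f.
Proof.
move=> /continuousP cf; apply: (measurability _ (RGenOpens.measurableE R)).
move=> _ [_ [a [b ->] <-]]; rewrite setTI.
by apply: sub_sigma_algebra; apply: cf; exact: interval_open.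
Qed.

Lemma measurable_entry m n i j :
  measurable_fun setT (fun v : 'M[R]_(m, n) => v i j).
Proof. by apply: continuous_mx_measurable; exact: coord_continuous. Qed.

Lemma measurable_mxE m n (f : T -> 'M[R]_(m, n)) i j :
  measurable_fun setT f -> measurable_fun setT (fun w => f w i j).
Proof. by move=> mf; apply: measurableT_comp (measurable_entry i j) mf. Qed.

(** The Borel sets of the matrix space are generated entrywise because an open set
    is a countable union of cubes with rational centres and radii [1 / k.+1]. *)
Lemma measurable_mx m n (f : T -> 'M[R]_(m, n)) :
  (forall i j, measurable_fun setT (fun w => f w i j)) -> measurable_fun setT f.
Proof.
move=> mf; apply: (@measurability _ _ _ _ setT f open erefl).
move=> _ [U oU <-]; rewrite setTI.
pose c (q : 'M[rat]_(m, n)) : 'M[R]_(m, n) := \matrix_(i, j) ratr (q i j).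
pose B (q : 'M[rat]_(m, n)) (k : nat) := ball (c q) (k.+1%:R^-1).
pose F (qk : 'M[rat]_(m, n) * nat) :=
  if `[< B qk.1 qk.2 `<=` U >] then f @^-1` B qk.1 qk.2 else set0.
have -> : f @^-1` U = \bigcup_qk F qk.
  apply/seteqP; split=> [w /= Uw|w [qk _]]; last first.
    by rewrite /F; case: ifPn => // /asboolP BU; exact: BU.
  have [e e0 eU] : exists2 e, 0 < e & ball (f w) e `<=` U.
    by have /nbhs_ballP[e e0 eU] := open_nbhs_nbhs (conj oU Uw); exists e.
  have e20 : 0 < e / 2 by rewrite divr_gt0.
  have [k] := ltr_add_invr e20; rewrite add0r => ke.
  have k0 : 0 < k.+1%:R^-1 :> R by rewrite invr_gt0.
  have /choice[q qP] : forall ij : 'I_m * 'I_n, exists q : rat,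
      `|ratr q - f w ij.1 ij.2| < k.+1%:R^-1.
    move=> [i j] /=; have [|q qP] := @rat_in_itvoo R
        (f w i j - k.+1%:R^-1) (f w i j + k.+1%:R^-1).
      by rewrite ltrBlDr -addrA ltrDl addr_gt0.
    by exists q; rewrite ltr_distl; move: qP; rewrite in_itv.
  exists (\matrix_(i, j) q (i, j), k) => //.
  have Bw : B (\matrix_(i, j) q (i, j)) k (f w).
    by split=> // i j; rewrite /ball/= !mxE; exact: (qP (i, j)).
  rewrite /F /=; case: ifPn => // /asboolP nBU; exfalso.
  apply: nBU => v Bv; apply: eU.
  rewrite (splitr e); apply: (@ball_triangle _ _ (c (\matrix_(i, j) q (i, j)))).
    by apply/ball_sym; apply: le_ball Bw; exact: ltW.
  by apply: le_ball Bv; exact: ltW.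
apply: countable_bigcupT_measurable => // -[q k]; rewrite /F; case: ifPn => // _.
rewrite /B [X in measurable X](_ : _ = \bigcap_(ij in [set: 'I_m * 'I_n])
    ((fun w => f w ij.1 ij.2) @^-1` `](c q ij.1 ij.2 - k.+1%:R^-1),
                                     (c q ij.1 ij.2 + k.+1%:R^-1)[)).
  apply: fin_bigcap_measurable => // -[i j] _.
  by rewrite -[X in measurable X]setTI; exact: mf.
apply/seteqP; split=> w /=.
  by move=> [_ Bw] [i j] _ /=; rewrite in_itv/= -ltr_distlC; exact: Bw.
move=> Bw; split; first by rewrite invr_gt0.
by move=> i j; have := Bw (i, j) I; rewrite /= in_itv/= -ltr_distlC.
Qed.

Lemma measurable_mulmx m n p (f : T -> 'M[R]_(m, n)) (g : T -> 'M[R]_(n, p)) :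
  measurable_fun setT f -> measurable_fun setT g ->
  measurable_fun setT (fun w => f w *m g w).
Proof.
move=> mf mg; apply: measurable_mx => i j; under eq_fun do rewrite mxE.
apply: measurable_sum => k.
by apply: measurable_funM; exact: measurable_mxE.
Qed.

Lemma measurable_mxD m n (f g : T -> 'M[R]_(m, n)) :
  measurable_fun setT f -> measurable_fun setT g ->
  measurable_fun setT (fun w => f w + g w).
Proof.
move=> mf mg; apply: measurable_mx => i j; under eq_fun do rewrite mxE.
by apply: measurable_funD; exact: measurable_mxE.
Qed.

Lemma measurable_col m n k (f : T -> 'M[R]_(m, n)) :
  measurable_fun setT f -> measurable_fun setT (fun w => col k (f w)).
Proof.
move=> mf; apply: measurable_mx => i j; under eq_fun do rewrite mxE.
exact: measurable_mxE.
Qed.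

End measurable_matrix.

Section integrable_matrix.
Context {R : realType} {dT : measure_display} {T : measurableType dT}.
Variable P : probability T R.
Implicit Types f g : T -> R.

Definition integrableR (f : T -> R) := P.-integrable setT (EFin \o f).

Lemma integrableR_measurable f : integrableR f -> measurable_fun setT f.
Proof. by move=> /integrableP[/measurable_EFinP]. Qed.

Lemma integrableR_cst c : integrableR (cst c).
Proof. exact: finite_measure_integrable_cst. Qed.

Lemma integrableRD f g : integrableR f -> integrableR g ->
  integrableR (fun w => f w + g w).
Proof. by move=> fi gi; have := integrableD measurableT fi gi. Qed.

Lemma integrableRZ c f : integrableR f -> integrableR (fun w => c * f w).
Proof. by move=> fi; have := integrableZl measurableT c fi. Qed.

Lemma integrableRB f g : integrableR f -> integrableR g ->
  integrableR (fun w => f w - g w).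
Proof. by move=> fi gi; have := integrableB measurableT fi gi. Qed.

Lemma integrableR_sum I (s : seq I) (h : I -> T -> R) :
  (forall i, integrableR (h i)) -> integrableR (fun w => \sum_(i <- s) h i w).
Proof.
move=> hi; elim: s => [|i s IH].
  by under eq_fun do rewrite big_nil; exact: integrableR_cst.
by under eq_fun do rewrite big_cons; exact: integrableRD.
Qed.

Lemma integrableR_le f g : measurable_fun setT f -> integrableR g ->
  (forall w, `|f w| <= g w) -> integrableR f.
Proof.
move=> mf gi fg; apply: (le_integrable measurableT _ _ gi).
  exact/measurable_EFinP.
by move=> w _; rewrite /= lee_fin (le_trans (fg w))// ler_norm.
Qed.

Lemma integrableR_norm f : integrableR f -> integrableR (fun w => `|f w|).
Proof. exact: integrable_norm. Qed.

Lemma integrable_mx_norm m n (X : T -> 'M[R]_(m, n)) :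
  measurable_fun setT X -> integrable_mx P X -> integrableR (fun w => `|X w|).
Proof.
move=> mX iX.
apply: (@integrableR_le _ (fun w => \sum_i \sum_j `|X w i j|)).
- apply: measurableT_comp mX.
  apply: continuous_mx_measurable => v; exact: norm_continuous.
- apply: integrableR_sum => i; apply: integrableR_sum => j.
  by apply: integrableR_norm; exact: iX.
- by move=> w; rewrite normr_id norm_le_sum.
Qed.

Lemma cvx_lip_measurable m n (phi : 'M[R]_(m, n) -> R) (X : T -> 'M[R]_(m, n)) :
  cvx_lip phi -> measurable_fun setT X ->
  measurable_fun setT (fun w => phi (X w)).
Proof.
move=> cphi mX; apply: measurableT_comp mX.
by apply: continuous_mx_measurable; exact: cvx_lip_continuous.
Qed.

Lemma cvx_lip_integrable m n (phi : 'M[R]_(m, n) -> R) (X : T -> 'M[R]_(m, n)) :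
  cvx_lip phi -> measurable_fun setT X -> integrable_mx P X ->
  integrableR (fun w => phi (X w)).
Proof.
move=> cphi mX iX; have [K K0 phiK] := cvx_lip_bound cphi.
apply: (@integrableR_le _ (fun w => K * (1 + `|X w|))) => //.
  exact: cvx_lip_measurable.
apply: integrableRZ; apply: integrableRD; first exact: integrableR_cst.
exact: integrable_mx_norm.
Qed.

Lemma RintegralE f : integrableR f ->
  (\int[P]_w f w)%:E = (\int[P]_w (f w)%:E)%E.
Proof. by move=> fi; rewrite fineK//; exact: integrable_fin_num. Qed.

End integrable_matrix.

Section independence.
Context {R : realType} {dT : measure_display} {T : measurableType dT}.
Variable P : probability T R.

(** Both sides are finite measures in [C] that agree on rectangles. *)
Lemma independent_rectangles d1 d2 (E1 : measurableType d1)
    (E2 : measurableType d2) (U : T -> E1) (V : T -> E2) (D : set T) :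
  measurable_fun setT U -> measurable_fun setT V -> measurable D ->
  (forall A B, measurable A -> measurable B ->
    P (U @^-1` A `&` V @^-1` B `&` D) = (P (U @^-1` A `&` V @^-1` B) * P D)%E) ->
  forall C : set (E1 * E2), measurable C ->
    P ((fun w => (U w, V w)) @^-1` C `&` D) =
    (P ((fun w => (U w, V w)) @^-1` C) * P D)%E.
Proof.
move=> mU mV mD UVD C mC.
have mUV : measurable_fun setT (fun w => (U w, V w)).
  exact/measurable_fun_pairP.
pose UV : {mfun T >-> (E1 * E2)%type} := HB.pack (fun w => (U w, V w))
  (isMeasurableFun.Build _ _ _ _ _ mUV).
have PD0 : 0 <= fine (P D) by rewrite fine_ge0.
pose m1 : {measure set (E1 * E2) -> \bar R} := pushforward (mrestr P mD) UV.
pose m2 : {measure set (E1 * E2) -> \bar R} :=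
  mscale (NngNum PD0) (pushforward P UV).
suff m12 : m1 mUV C = m2 mUV C.
  transitivity (m1 mUV C) => //; rewrite m12 /= /mscale /= muleC.
  by rewrite fineK// fin_num_measure.
pose G : set (set (E1 * E2)) :=
  [set A `*` B | A in measurable & B in measurable].
apply: (measure_unique G (fun=> setT) _ _ _ _ (m1 mUV) (m2 mUV)) => //.
- by rewrite measurable_prod_measurableType.
- move=> _ _ [A1 mA1 [B1 mB1 <-]] [A2 mA2 [B2 mB2 <-]].
  exists (A1 `&` A2); first exact: measurableI.
  by exists (B1 `&` B2); [exact: measurableI|rewrite setXI].
- by move=> _; exists setT => //; exists setT => //; rewrite setXTT.
- by rewrite bigcup_const.
- move=> _ [A mA [B mB <-]].
  transitivity (P (U @^-1` A `&` V @^-1` B `&` D)) => //.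
  by rewrite UVD//= /mscale /= muleC fineK// fin_num_measure.
- move=> _; rewrite /= /pushforward /mrestr /=.
  by rewrite preimage_setT setTI (le_lt_trans (probability_le1 P mD))// ltry.
Qed.

Section pair.
Context d1 d2 (E1 : measurableType d1) (E2 : measurableType d2).
Variables (U : T -> E1) (V : T -> E2).
Hypotheses (mU : measurable_fun setT U) (mV : measurable_fun setT V).
Hypothesis UV_indep : forall A B, measurable A -> measurable B ->
  P (U @^-1` A `&` V @^-1` B) = (P (U @^-1` A) * P (V @^-1` B))%E.

Let U' : {mfun T >-> E1} := HB.pack U (isMeasurableFun.Build _ _ _ _ _ mU).
Let V' : {mfun T >-> E2} := HB.pack V (isMeasurableFun.Build _ _ _ _ _ mV).

Let mUV : measurable_fun setT (fun w => (U w, V w)).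
Proof. exact/measurable_fun_pairP. Qed.

Let UV : {mfun T >-> (E1 * E2)%type} := HB.pack (fun w => (U w, V w))
  (isMeasurableFun.Build _ _ _ _ _ mUV).

Let joint_law C : measurable C ->
  (distribution P U' \x distribution P V')%E C = distribution P UV C.
Proof.
by move=> mC; apply: product_measure_unique.
Qed.

Lemma independent_integrableM (f : E1 -> R) (g : E2 -> R) :
  measurable_fun setT f -> measurable_fun setT g ->
  integrableR P (fun w => f (U w)) -> integrableR P (fun w => g (V w)) ->
  integrableR P (fun w => f (U w) * g (V w)).
Proof.
move=> mf mg fi gi.
pose h (z : E1 * E2) := f z.1 * g z.2.
have mh : measurable_fun setT h.
  by apply: measurable_funM; apply: measurableT_comp.
have mnh : measurable_fun setT (fun z => `|h z|%:E).
  by apply/measurable_EFinP; exact: measurableT_comp.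
apply/integrableP; split.
  by apply/measurable_EFinP; exact: (measurableT_comp mh mUV).
rewrite [ltLHS](_ : _ = \int[distribution P UV]_z `|h z|%:E)%E; last first.
  by rewrite ge0_integral_distribution.
rewrite -(eq_measure_integral _ (fun C mC _ => joint_law mC)).
rewrite fubini_tonelli1// /fubini_F/=.
have mnf : measurable_fun setT (fun x => `|f x|%:E).
  by apply/measurable_EFinP; exact: measurableT_comp.
have mng : measurable_fun setT (fun x => `|g x|%:E).
  by apply/measurable_EFinP; exact: measurableT_comp.
under eq_integral => x _.
  under eq_integral => y _ do rewrite /h/= normrM EFinM.
  rewrite ge0_integralZl//; over.
rewrite /= ge0_integralZr//; last exact: integral_ge0.
rewrite lte_mul_pinfty//.
- exact: integral_ge0.
- rewrite ge0_integral_distribution//.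
  exact: (integrable_fin_num measurableT (integrableR_norm fi)).
- rewrite ge0_integral_distribution//.
  by have /integrableP[_] := gi.
Qed.

(** The law of the pair is the product of the marginals, so this is Fubini's
    theorem. *)
Lemma independent_Rintegral (H : E1 * E2 -> R) : measurable_fun setT H ->
  integrableR P (fun w => H (U w, V w)) ->
  (forall x, integrableR P (fun w => H (x, V w))) ->
  integrableR P (fun w => \int[P]_w' H (U w, V w')) /\
  \int[P]_w H (U w, V w) = \int[P]_w \int[P]_w' H (U w, V w').
Proof.
move=> mH Hi Hx.
have mH' : measurable_fun setT (EFin \o H) by exact/measurable_EFinP.
have HI : (distribution P U' \x distribution P V')%E.-integrable setT (EFin \o H).
  apply/integrableP; split=> //.
  rewrite (eq_measure_integral _ (fun C mC _ => joint_law mC)).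
  rewrite ge0_integral_distribution//; last exact: measurableT_comp.
  by have /integrableP[_] := Hi.
have FE x : fubini_F (distribution P V') (EFin \o H) x =
    (\int[P]_w' H (x, V w'))%:E.
  rewrite RintegralE// /fubini_F.
  rewrite (@integral_distribution _ _ _ _ _ _ V'
    (fun y => (EFin \o H) (x, y)))//.
    exact: measurableT_comp.
  exact: Hx.
have := integral12_prod_meas1 HI; have := integrable_fubini_F HI.
rewrite (funext FE) => IF IE.
have mF : measurable_fun setT (fun x => \int[P]_w' H (x, V w')).
  by move/integrableP : IF => [/measurable_EFinP].
have iF : integrableR P (fun w => \int[P]_w' H (U w, V w')).
  move/integrableP : IF => [mF' ltF]; apply/integrableP; split.
    by apply/measurable_EFinP; exact: (measurableT_comp mF mU).
  rewrite ge0_integral_distribution// in ltF.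
  exact: measurableT_comp.
split=> //; congr fine.
rewrite -[RHS](@integral_distribution _ _ _ _ _ _ U'
  (fun x => (\int[P]_w' H (x, V w'))%:E))//.
  rewrite IE (eq_measure_integral _ (fun C mC _ => joint_law mC)).
  by rewrite integral_distribution.
exact/measurable_EFinP.
Qed.

End pair.

End independence.

(** * Radial distributions *)

Section expectations_of_convex_functions.
Context {R : realType} {dT : measure_display} {T : measurableType dT}.
Variable P : probability T R.

Lemma mulmx_norm_le m n p (A : 'M[R]_(m, n)) (B : 'M[R]_(n, p)) :
  `|A *m B| <= n%:R * `|A| * `|B|.
Proof.
rewrite [leLHS]/Num.Def.normr/= mx_normrE; apply/bigmax_leP; split => /=.
  by rewrite !mulr_ge0.
move=> [i j] _ /=; rewrite mxE (le_trans (ler_norm_sum _ _ _))//.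
apply: (@le_trans _ _ (\sum_(k < n) `|A| * `|B|)).
  by apply: ler_sum => k _; rewrite normrM ler_pM// entry_le_norm.
by rewrite sumr_const card_ord -[leLHS]mulr_natl mulrA.
Qed.

(** Means of convex functions are convex, and linear growth uniform enough to be
    integrated makes them Lipschitz by [cvx_lip_growth]. *)
Lemma Rintegral_cvx_lip (V : normedModType R) (F : V -> T -> R) (a : T -> R) :
  (forall w, cvx_fun (fun c => F c w)) -> (forall c, integrableR P (F c)) ->
  integrableR P a -> (forall c w, F c w <= a w * (1 + `|c|)) ->
  cvx_lip (fun c => \int[P]_w F c w).
Proof.
move=> cF iF ia Fa; apply: (@cvx_lip_growth _ _ _ (\int[P]_w a w)).
  move=> x y s s01.
  apply: (@le_trans _ _ (\int[P]_w (s * F x w + (1 - s) * F y w))).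
    apply: le_Rintegral => //; first exact: iF.
      by apply: integrableRD; apply: integrableRZ; exact: iF.
    by move=> w _; exact: cF.
  rewrite RintegralD//; [|exact/integrableRZ/iF|exact/integrableRZ/iF].
  by rewrite !RintegralZl//; exact: iF.
move=> c; rewrite -RintegralZr//; apply: le_Rintegral => //; first exact: iF.
by under eq_fun do rewrite mulrC; exact: integrableRZ.
Qed.

Lemma integrable_mx_mull m n p (M : 'M[R]_(m, n)) (Z : T -> 'M[R]_(n, p)) :
  integrable_mx P Z -> integrable_mx P (fun w => M *m Z w).
Proof.
move=> iZ i j; have : integrableR P (fun w => \sum_k M i k * Z w k j).
  by apply: integrableR_sum => k; apply: integrableRZ; exact: iZ.
by apply: eq_integrable => // w _; rewrite /= mxE.
Qed.

Section radial.
Context {d q : nat}.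
Variable Z : T -> 'cV[R]_q.
Hypotheses (mZ : measurable_fun setT Z) (iZ : integrable_mx P Z)
  (rZ : radial P Z).

Lemma radial_Rintegral (h : 'cV[R]_q -> R) (O : 'M[R]_q) : orthogonal_mx O ->
  measurable_fun setT h -> integrableR P (fun w => h (Z w)) ->
  integrableR P (fun w => h (O *m Z w)) ->
  \int[P]_w h (O *m Z w) = \int[P]_w h (Z w).
Proof.
move=> OO mh hZ hOZ.
have mOZ : measurable_fun setT (fun w => O *m Z w).
  by apply: measurable_mulmx.
pose Z' : {mfun T >-> 'cV[R]_q} := HB.pack Z (isMeasurableFun.Build _ _ _ _ _ mZ).
pose OZ' : {mfun T >-> 'cV[R]_q} := HB.pack (fun w => O *m Z w)
  (isMeasurableFun.Build _ _ _ _ _ mOZ).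
have mh' : measurable_fun setT (EFin \o h) by exact/measurable_EFinP.
congr fine.
rewrite -[LHS](@integral_distribution _ _ _ _ _ P OZ' (EFin \o h))//.
rewrite -[RHS](@integral_distribution _ _ _ _ _ P Z' (EFin \o h))//.
by apply: eq_measure_integral => A mA _; exact: rZ.
Qed.

(** [M = N *m C] with [C] a contraction; the mean of [psi (N *m C *m Z)] is convex
    in [C] and takes the same value at all orthogonal [C], by the radial
    distribution of [Z]. *)
Lemma radial_psd_le (psi : 'cV[R]_d -> R) (M N : 'M[R]_(d, q)) :
  cvx_lip psi -> psd_le (M *m M^T) (N *m N^T) ->
  \int[P]_w psi (M *m Z w) <= \int[P]_w psi (N *m Z w).
Proof.
move=> cpsi /psd_le_factor[C -> CP].
have iMZ (M' : 'M[R]_(d, q)) : integrableR P (fun w => psi (M' *m Z w)).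
  apply: cvx_lip_integrable => //; first exact: measurable_mulmx.
  exact: integrable_mx_mull.
have iNZ := integrable_mx_norm mZ iZ.
apply: (contraction_max (G := fun C => \int[P]_w psi (N *m C *m Z w))) CP;
  last first.
  move=> O OO; under eq_Rintegral do rewrite -mulmxA.
  rewrite (radial_Rintegral (h := fun z => psi (N *m z)))//.
    by apply: cvx_lip_measurable => //; exact: measurable_mulmx.
  by have := iMZ (N *m O); under eq_fun do rewrite -mulmxA.
have [K K0 psiK] := cvx_lip_bound cpsi.
apply: (@Rintegral_cvx_lip _ _
  (fun w => K * (1 + q%:R * (q%:R * `|N|) * `|Z w|))).
- move=> w C1 C2 s s01; rewrite mulmxDr mulmxDl -!scalemxAr -!scalemxAl.
  exact: cpsi.1.
- by move=> C1; exact: iMZ.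
- apply: integrableRZ; apply: integrableRD; first exact: integrableR_cst.
  exact: integrableRZ.
move=> C1 w; apply: (le_trans (ler_norm _)); apply: (le_trans (psiK _)).
rewrite /= -[leRHS]mulrA ler_wpM2l// mulrDl mul1r.
apply: lerD; first by rewrite lerDl.
have h1 : `|N *m C1 *m Z w| <= q%:R * (q%:R * `|N|) * `|Z w| * `|C1|.
  apply: (le_trans (mulmx_norm_le _ _)); rewrite -mulrA -!mulrA ler_wpM2l//.
  rewrite (mulrC `|Z w|) !mulrA ler_wpM2r// mulmx_norm_le//.
by apply: (le_trans h1); rewrite ler_wpM2l// ?lerDr// !mulr_ge0.
Qed.

End radial.

End expectations_of_convex_functions.

(** * One step of the recursion *)

Section euclidean_norm.
Context {R : realType}.

Lemma norm_le_enorm m n (A : 'M[R]_(m, n)) : `|A| <= enorm A.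
Proof.
rewrite [leLHS]/Num.Def.normr/= mx_normrE; apply/bigmax_leP.
split=> [|[i j] _ /=]; first exact: sqrtr_ge0.
rewrite -sqrtr_sqr ler_wsqrtr// (bigD1 i)//= (bigD1 j)//= -addrA lerDl.
rewrite addr_ge0// sumr_ge0// => k _; rewrite ?sqr_ge0//.
by rewrite sumr_ge0// => l _; rewrite sqr_ge0.
Qed.

Lemma enorm_le_norm m n (A : 'M[R]_(m, n)) :
  enorm A <= Num.sqrt (m%:R * n%:R) * `|A|.
Proof.
rewrite -[X in _ * X]ger0_norm// -sqrtr_sqr -sqrtrM ?mulr_ge0//.
apply: ler_wsqrtr; apply: (@le_trans _ _ (\sum_(i < m) \sum_(j < n) `|A| ^+ 2)).
  apply: ler_sum => i _; apply: ler_sum => j _.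
  by rewrite -real_normK ?num_real// lerXn2r ?nnegrE// entry_le_norm.
rewrite [leLHS](_ : _ = m%:R * n%:R * `|A| ^+ 2)//.
under eq_bigr do rewrite sumr_const card_ord.
by rewrite sumr_const card_ord -mulrnA -[LHS]mulr_natl natrM; ring.
Qed.

Lemma linear_growth_norm d q (theta : 'cV[R]_d -> 'M[R]_(d, q)) :
  linear_growth theta ->
  exists2 C, 0 <= C & forall x, `|theta x| <= C * (1 + `|x|).
Proof.
move=> [C thetaC]; pose D : R := Num.sqrt (d%:R * 1%:R).
have D0 : 0 <= D by exact: sqrtr_ge0.
exists (`|C| * (1 + D)); first by rewrite mulr_ge0// addr_ge0.
move=> x; apply: (le_trans (norm_le_enorm _)); apply: (le_trans (thetaC x)).
have ex0 : 0 <= enorm x by exact: sqrtr_ge0.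
apply: (@le_trans _ _ (`|C| * (1 + enorm x))).
  by rewrite ler_wpM2r ?ler_norm// addr_ge0.
rewrite -mulrA ler_wpM2l//; have := enorm_le_norm x; rewrite -/D.
by have := normr_ge0 x; nra.
Qed.

End euclidean_norm.

Section one_step.
Context {R : realType} {dT : measure_display} {T : measurableType dT}.
Variable P : probability T R.
Context {d q m : nat}.
Variables (theta : 'cV[R]_d -> 'M[R]_(d, q)) (a b : 'I_m).

(** The update adds the new position to column [b], where the stopped paths to
    which it is applied are zero. *)
Definition step (y : 'M[R]_(d, m)) (z : 'cV[R]_q) : 'M[R]_(d, m) :=
  y + (col a y + theta (col a y) *m z) *m delta_mx (0 : 'I_1) b.

Lemma cvx_lip_column (phi : 'M[R]_(d, m) -> R) y (c : 'cV[R]_d) : cvx_lip phi ->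
  cvx_lip (fun x : 'cV[R]_d => phi (y + (c + x) *m delta_mx (0 : 'I_1) b)).
Proof.
move=> [cphi [K K0 phiK]]; split=> [x1 x2 s s01|].
  have -> : y + (c + (s *: x1 + (1 - s) *: x2)) *m delta_mx (0 : 'I_1) b =
     s *: (y + (c + x1) *m delta_mx (0 : 'I_1) b) +
     (1 - s) *: (y + (c + x2) *m delta_mx (0 : 'I_1) b).
    rewrite !mulmxDl !scalerDr -!scalemxAl.
    by apply/matrixP => i j; rewrite !mxE; ring.
  exact: cphi.
exists (K * `|delta_mx (0 : 'I_1) b : 'rV[R]_m|); first by rewrite mulr_ge0.
move=> x1 x2; apply: (le_trans (phiK _ _)); rewrite -mulrA ler_wpM2l//.
rewrite opprD addrACA subrr add0r -mulmxBl [c + x1]addrC opprD addrA addrK.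
by rewrite (le_trans (mulmx_norm_le _ _))// mul1r mulrC.
Qed.

Hypothesis theta_growth : linear_growth theta.

Lemma step_norm_le : exists2 C, 0 <= C &
  forall y z, `|step y z| <= (1 + `|y|) * (C * (1 + `|z|)).
Proof.
have [C C0 thetaC] := linear_growth_norm theta_growth.
pose D := `|delta_mx (0 : 'I_1) b : 'rV[R]_m|.
have D0 : 0 <= D by exact: normr_ge0.
exists (1 + D + q%:R * C * D); first by rewrite !addr_ge0 ?mulr_ge0.
move=> y z; have coly : `|col a y| <= `|y|.
  rewrite [leLHS]/Num.Def.normr/= mx_normrE; apply/bigmax_leP.
  by split=> // -[i j] _ /=; rewrite mxE entry_le_norm.
have thz : `|theta (col a y) *m z| <= q%:R * C * (1 + `|y|) * `|z|.
  apply: (le_trans (mulmx_norm_le _ _)); rewrite ler_wpM2r// -mulrA ler_wpM2l//.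
  by apply: (le_trans (thetaC _)); rewrite ler_wpM2l// lerD2l.
have bD : `|(col a y + theta (col a y) *m z) *m delta_mx (0 : 'I_1) b| <=
    (`|y| + q%:R * C * (1 + `|y|) * `|z|) * D.
  apply: (le_trans (mulmx_norm_le _ _)); rewrite mul1r ler_wpM2r//.
  by apply: (le_trans (ler_normD _ _)); exact: lerD.
apply: (le_trans (ler_normD _ _)); apply: (le_trans (lerD (lexx _) bD)).
have y0 := normr_ge0 y; have z0 := normr_ge0 z.
rewrite -subr_ge0 [X in 0 <= X](_ : _ = (1 + D) * (1 + `|z| + `|y| * `|z|) +
  q%:R * C * D * (1 + `|y|)); last by ring.
by rewrite addr_ge0// !mulr_ge0// !addr_ge0// mulr_ge0.
Qed.

Variable V : T -> 'cV[R]_q.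
Hypotheses (mV : measurable_fun setT V) (iV : integrable_mx P V).

Definition transition (phi : 'M[R]_(d, m) -> R) (y : 'M[R]_(d, m)) : R :=
  \int[P]_w phi (step y (V w)).

Lemma step_integrable phi y : cvx_lip phi ->
  integrableR P (fun w => phi (step y (V w))).
Proof.
move=> cphi; have := cvx_lip_column y (col a y) cphi.
move/(@cvx_lip_integrable _ _ _ P _ _ _ (fun w => theta (col a y) *m V w)); apply.
  exact: measurable_mulmx.
exact: integrable_mx_mull.
Qed.

Hypotheses (rV : radial P V) (theta_convex : matrix_convex theta).

(** Matrix convexity and [radial_psd_le] replace the coefficient at the convex
    combination by the combination of [theta x] and [theta y *m O]; convexity of
    [phi] splits the mean, and [O] disappears since [O *m V] is distributed as
    [V]. *)
Lemma transition_cvx phi : cvx_lip phi -> cvx_fun (transition phi).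
Proof.
move=> cphi x y s s01; have [ O OO] := theta_convex (col a x) (col a y) s01.
pose S := s *: theta (col a x) + (1 - s) *: (theta (col a y) *m O).
pose z := s *: x + (1 - s) *: y.
have colz : col a z = s *: col a x + (1 - s) *: col a y.
  by apply/matrixP => i j; rewrite !mxE.
have ipsi := cvx_lip_column z (col a z) cphi.
rewrite /= -/S -colz => thS; have := radial_psd_le mV iV rV ipsi thS.
move/le_trans; apply.
pose OV w := O *m V w.
have mOV : measurable_fun setT OV by exact: measurable_mulmx.
have iOV : integrable_mx P OV by exact: integrable_mx_mull.
have iy : integrableR P (fun w => phi (step y (OV w))).
  have := cvx_lip_column y (col a y) cphi.
  move/(@cvx_lip_integrable _ _ _ P _ _ _
    (fun w => theta (col a y) *m OV w)); apply.
    exact: measurable_mulmx.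
  exact: integrable_mx_mull.
have <- : \int[P]_w phi (step y (OV w)) = transition phi y.
  apply: (radial_Rintegral mV rV (h := fun v => phi (step y v)) OO) => //.
    have := cvx_lip_column y (col a y) cphi.
    move/(@cvx_lip_measurable _ _ _ _ _ _
      (fun v : 'cV_q => theta (col a y) *m v)); apply.
    exact: measurable_mulmx.
  exact: step_integrable.
rewrite -!RintegralZl//; last exact: step_integrable.
rewrite -RintegralD//; [|exact/integrableRZ/step_integrable|exact: integrableRZ].
apply: le_Rintegral => //.
- apply: (cvx_lip_integrable ipsi); first exact: measurable_mulmx.
  exact: integrable_mx_mull.
- by apply: integrableRD; apply: integrableRZ => //; exact: step_integrable.
move=> w _; apply: le_trans (cphi.1 _ _ _ s01).
rewrite le_eqVlt; apply/orP; left; apply/eqP; congr phi.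
rewrite /step /OV colz /z /S !mulmxDl !scalerDr -!scalemxAl !mulmxA.
by apply/matrixP => i j; rewrite !mxDE; ring.
Qed.

Lemma transition_cvx_lip phi : cvx_lip phi -> cvx_lip (transition phi).
Proof.
move=> cphi; have [C C0 stepC] := step_norm_le.
have [K K0 phiK] := cvx_lip_bound cphi.
have iV' := integrable_mx_norm mV iV.
pose g w := K * (1 + C * (1 + `|V w|)).
have ig : integrableR P g.
  apply: integrableRZ; apply: integrableRD; first exact: integrableR_cst.
  by apply: integrableRZ; apply: integrableRD => //; exact: integrableR_cst.
(* [g w] bounds [phi (step y (V w)) / (1 + `|y|)] uniformly in [y] *)
apply: (@cvx_lip_growth _ _ _ (\int[P]_w g w)); first exact: transition_cvx.
move=> y; rewrite -RintegralZr//; apply: le_Rintegral => //.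
- exact: step_integrable.
- by under eq_fun do rewrite mulrC; exact: integrableRZ.
move=> w _; apply: (le_trans (ler_norm _)); apply: (le_trans (phiK _)).
rewrite /g -[leRHS]mulrA ler_wpM2l// mulrDl mul1r.
rewrite [_ * (1 + `|y|)]mulrC lerD// ?stepC//.
by rewrite lerDl.
Qed.

End one_step.

Lemma cvx_lip_mulmx (R : realType) d q (psi : 'cV[R]_d -> R) (M : 'M[R]_(d, q)) :
  cvx_lip psi -> cvx_lip (fun z : 'cV[R]_q => psi (M *m z)).
Proof.
move=> [cpsi [K K0 psiK]]; split=> [z1 z2 s s01|].
  by rewrite mulmxDr -!scalemxAr; exact: cpsi.
exists (K * (q%:R * `|M|)); first by rewrite !mulr_ge0.
move=> z1 z2; apply: (le_trans (psiK _ _)); rewrite -mulrA ler_wpM2l//.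
by rewrite -mulmxBr mulmx_norm_le.
Qed.

Lemma cvx_lip_step (R : realType) d q m (theta : 'cV[R]_d -> 'M[R]_(d, q))
    (a b : 'I_m) phi y :
  cvx_lip phi -> cvx_lip (fun z : 'cV[R]_q => phi (step theta a b y z)).
Proof.
move=> cphi.
exact: (cvx_lip_mulmx (theta (col a y)) (cvx_lip_column b y (col a y) cphi)).
Qed.

(** * Noise with the same barycentres *)

Section stationary.
Context {R : realType} {dT : measure_display} {T : measurableType dT}.
Variable P : probability T R.
Context {q : nat}.

Lemma measurable_mx_set1 m n (v : 'M[R]_(m, n)) : measurable [set v].
Proof.
rewrite (_ : [set v] = \bigcap_(ij in [set: 'I_m * 'I_n])
    ((fun u : 'M[R]_(m, n) => u ij.1 ij.2) @^-1` [set v ij.1 ij.2])).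
  apply: fin_bigcap_measurable => // ij _; rewrite -[X in measurable X]setTI.
  exact: measurable_entry.
apply/seteqP; split=> [u -> //|u uv]; apply/matrixP => i j.
exact: (uv (i, j)).
Qed.

(** Jensen's inequality for the conditional mean of [Z] given [f (Z)], in the case
    where [f] moves points only to the finitely many values in [s]: on the event
    where [f (Z)] is [g], the subgradient of [psi] at [g] gives a bound whose
    linear term has mean zero. *)
Lemma stationary_Rintegral_le (Z : T -> 'cV[R]_q) (f : 'cV[R]_q -> 'cV[R]_q)
    (s : seq 'cV[R]_q) :
  measurable_fun setT Z -> integrable_mx P Z -> measurable_fun setT f ->
  integrable_mx P (f \o Z) -> (forall z, f z \in s \/ f z = z) ->
  (forall g, g \in s -> forall i,
    \int[P]_w (\1_[set w | f (Z w) = g] w * (Z w i 0 - g i 0)) = 0) ->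
  forall psi : 'cV[R]_q -> R, cvx_lip psi ->
  \int[P]_w psi (f (Z w)) <= \int[P]_w psi (Z w).
Proof.
move=> mZ iZ mf ifZ fs sE psi cpsi.
have /choice[G GP] : forall x, exists G, forall y,
    psi x + mxdot G (y - x) <= psi y.
  by move=> x; exact: (subgradient x cpsi.1).
have mfZ : measurable_fun setT (f \o Z) by exact: measurableT_comp.
pose I g w := \1_[set w | f (Z w) = g] w : R.
have iI g i : integrableR P (fun w => I g w * (Z w i 0 - g i 0)).
  apply: (@integrableR_le _ _ _ _ _ (fun w => `|Z w i 0 - g i 0|)).
  - apply: measurable_funM; last first.
      by apply: measurable_funB => //; exact: measurable_mxE.
    apply: measurable_indic; rewrite -[X in measurable X]setTI.
    exact: (mfZ measurableT _ (measurable_mx_set1 g)).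
  - apply: integrableR_norm; apply: integrableRB; first exact: iZ.
    exact: integrableR_cst.
  - move=> w; rewrite normrM ler_piMl// /I indicE.
    by case: (_ \in _); rewrite ?normr1// normr0.
pose h g w := \sum_i G g i 0 * (I g w * (Z w i 0 - g i 0)).
have ih g : integrableR P (h g).
  by apply: integrableR_sum => i; exact: integrableRZ.
have Rsum (I0 : Type) (r : seq I0) (F : I0 -> T -> R) :
    (forall k, integrableR P (F k)) ->
    \int[P]_w (\sum_(k <- r) F k w) = \sum_(k <- r) \int[P]_w F k w.
  move=> iF; elim: r => [|k r IH].
    under eq_Rintegral do rewrite big_nil.
    by rewrite big_nil Rintegral_cst// mul0r.
  under eq_Rintegral do rewrite big_cons.
  by rewrite big_cons RintegralD ?IH//; [exact: iF|exact: integrableR_sum].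
have h0 g : g \in s -> \int[P]_w h g w = 0.
  move=> gs; rewrite Rsum => [|i]; last exact: integrableRZ.
  rewrite big1// => i _; rewrite RintegralZl//; last exact: iI.
  by rewrite sE// mulr0.
have hE g w : h g w = I g w * mxdot (G g) (Z w - g).
  rewrite /h /mxdot mulr_sumr; apply: eq_bigr => i _.
  by rewrite big_ord1 !mxE; ring.
have ipsiZ := cvx_lip_integrable cpsi mZ iZ.
have ipsif : integrableR P (fun w => psi (f (Z w))).
  exact: (cvx_lip_integrable cpsi mfZ ifZ).
have <- : \int[P]_w (psi (f (Z w)) + \sum_(g <- undup s) h g w) =
    \int[P]_w psi (f (Z w)).
  rewrite RintegralD//; last exact: integrableR_sum.
  by rewrite Rsum// big_seq big1 ?addr0// => g; rewrite mem_undup; exact: h0.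
apply: le_Rintegral => //.
  by apply: integrableRD => //; exact: integrableR_sum.
move=> w _; under eq_bigr do rewrite hE.
have I0 g : f (Z w) != g -> I g w = 0.
  by move=> /eqP fg; rewrite /I indicE memNset.
have [fZs|fZs] := boolP (f (Z w) \in s).
  rewrite (bigD1_seq (f (Z w))) ?mem_undup ?undup_uniq//=.
  rewrite big1 ?addr0 => [|g gf]; last by rewrite I0 ?mul0r// eq_sym.
  by rewrite /I indicE mem_set// mul1r; exact: GP.
rewrite big_seq big1 ?addr0 => [|g]; last first.
  by rewrite mem_undup => gs; rewrite I0 ?mul0r//; apply: contraNneq fZs => ->.
by have [|->//] := fs (Z w); rewrite (negbTE fZs).
Qed.

End stationary.

(** * Convex order from Lipschitz convex functions *)

Section convex_order.
Context {R : realType} {dT : measure_display} {T : measurableType dT}.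
Variable P : probability T R.

(** Neither integral needs to be finite: the inequality is obtained separately for
    the positive and the negative parts. *)
Lemma le_integral_measurable (f g : T -> R) :
  measurable_fun setT f -> measurable_fun setT g -> (forall w, f w <= g w) ->
  (\int[P]_w (f w)%:E <= \int[P]_w (g w)%:E)%E.
Proof.
move=> /measurable_EFinP mf /measurable_EFinP mg fg.
rewrite integralE [leRHS]integralE leeB//.
- apply: ge0_le_integral => //.
  + exact: measurable_funepos.
  + exact: measurable_funepos.
  + by move=> w _; apply: (@funepos_le _ _ setT) => [v _|]; rewrite ?lee_fin// inE.
- apply: ge0_le_integral => //.
  + exact: measurable_funeneg.
  + exact: measurable_funeneg.
  + by move=> w _; apply: (@funeneg_le _ _ setT) => [v _|]; rewrite ?lee_fin// inE.
Qed.

Lemma eventually_eq_cvg (f : nat -> R) (l : R) :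
  (forall k, f k <= f k.+1) -> (forall k, f k <= l) -> (exists k, f k = l) ->
  f @ \oo --> l.
Proof.
move=> fS fl [k fk]; apply: cvg_near_cst; exists k => // j /= kj.
apply/eqP; rewrite eq_le fl -fk.
by apply: (@homo_leq _ f (fun x y => x <= y)) => //; exact: le_trans.
Qed.

(** Monotone convergence applied to the nonnegative functions [f k - f 0]. *)
Lemma integral_approx_le (f : nat -> T -> R) (g : T -> R) (M : R) :
  (forall k, integrableR P (f k)) -> (forall k w, f k w <= f k.+1 w) ->
  (forall k w, f k w <= g w) -> (forall w, exists k, f k w = g w) ->
  (forall k, \int[P]_w f k w <= M) ->
  (\int[P]_w (g w)%:E <= M%:E)%E.
Proof.
move=> fi fS fg fE fM.
have mf k : measurable_fun setT (f k) by exact: integrableR_measurable (fi k).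
have cvgf w : f ^~ w @ \oo --> g w by exact: eventually_eq_cvg.
have mg : measurable_fun setT g.
  by apply: (measurable_fun_cvg mf) => w _; exact: cvgf.
have fmono w j k : (j <= k)%N -> f j w <= f k w.
  by apply: (@homo_leq _ (f^~ w) (fun x y => x <= y)) => //; exact: le_trans.
pose h k w := (f k w - f 0 w)%:E.
have hcvg w : h ^~ w @ \oo --> (g w - f 0 w)%:E.
  apply/cvg_EFin; first exact: nearW.
  by apply: cvgB; [exact: cvgf|exact: cvg_cst].
have h0 k w : setT w -> (0 <= h k w)%E by rewrite lee_fin subr_ge0 fmono.
have mh k : measurable_fun setT (h k).
  by apply/measurable_EFinP; exact: measurable_funB.
have hnd w : setT w -> nondecreasing_seq (h ^~ w).
  by move=> _ j k jk; rewrite lee_fin lerD2r fmono.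
have hle k : (\int[P]_w h k w <= (M - \int[P]_w f 0 w)%:E)%E.
  rewrite -RintegralE; last exact: integrableRB.
  by rewrite lee_fin RintegralB; [rewrite lerD2r|by []|exact: fi|exact: fi].
have gle : (\int[P]_w (g w - f 0 w)%:E <= (M - \int[P]_w f 0 w)%:E)%E.
  have hP := cvg_monotone_convergence measurableT mh h0 hnd (mu := P).
  have <- : (\int[P]_w limn (h ^~ w) = \int[P]_w (g w - f 0 w)%:E)%E.
    by apply: eq_integral => w _; apply/cvg_lim => //; exact: hcvg.
  rewrite -(cvg_lim _ hP)//; apply: lime_le.
    by apply/cvg_ex; eexists; exact: hP.
  exact: nearW.
have igf : integrableR P (fun w => g w - f 0 w).
  apply/integrableP; split.
    by apply/measurable_EFinP; exact: measurable_funB.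
  under eq_integral do rewrite /= ger0_norm ?subr_ge0//.
  by rewrite (le_lt_trans gle)// ltry.
have ig : integrableR P g.
  by have := integrableRD igf (fi 0); under eq_fun do rewrite subrK.
move: gle; rewrite -!RintegralE// !lee_fin.
by rewrite RintegralB; [rewrite lerD2r|by []|exact: ig|exact: fi].
Qed.

(** When the mean of [phi (Y)] is infinite there is nothing to prove; otherwise it
    bounds the means of the Lipschitz approximations of [phi] at [X]. *)
Lemma cvx_le_of_lip m n (X Y : T -> 'M[R]_(m, n)) :
  measurable_fun setT X -> measurable_fun setT Y ->
  integrable_mx P X -> integrable_mx P Y ->
  (forall phi, cvx_lip phi -> \int[P]_w phi (X w) <= \int[P]_w phi (Y w)) ->
  cvx_le P X Y.
Proof.
move=> mX mY iX iY XY; split=> // phi /convex_functionP cphi.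
have [f [cf fS fphi fE]] := cvx_approx cphi.
have fi k : integrableR P (fun w => f k (X w)) by exact: cvx_lip_integrable.
have mphiY : measurable_fun setT (fun w => phi (Y w)).
  apply: (@measurable_fun_cvg _ _ _ _ (fun k w => f k (Y w))) => [k|w _].
    exact: cvx_lip_measurable.
  by apply: eventually_eq_cvg => //; exact: fE.
have fY k : ((\int[P]_w f k (X w))%:E <= \int[P]_w (phi (Y w))%:E)%E.
  apply: (@le_trans _ _ (\int[P]_w f k (Y w))%:E); first by rewrite lee_fin XY.
  rewrite RintegralE; last exact: cvx_lip_integrable.
  by apply: le_integral_measurable => //; exact: cvx_lip_measurable.
rewrite unlock.
case: (\int[P]_w (phi (Y w))%:E)%E fY => [M fY| _|/(_ 0)//]; last by rewrite leey.
exact: (integral_approx_le fi).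
Qed.

End convex_order.

(** * Induction along time *)

Section process.
Context {R : realType} {dT : measure_display} {T : measurableType dT}.
Variable P : probability T R.
Context {d q n : nat}.
Variables (X0 : T -> 'cV[R]_d) (Z : 'I_n -> T -> 'cV[R]_q).
Variable theta : 'I_n -> 'cV[R]_d -> 'M[R]_(d, q).
Hypotheses (mX0 : measurable_fun setT X0)
  (mZ : forall k, measurable_fun setT (Z k))
  (Z_indep : mutually_independent P Z)
  (X0_indep : independent_mx P X0 (path_mx Z))
  (theta_borel : forall k, measurable_fun setT (theta k))
  (theta_growth : forall k, linear_growth (theta k)).

(** The path up to time [k], padded with zero columns so that the matrix type does
    not depend on [k]. *)
Definition stopped_path (X : 'I_n.+1 -> T -> 'cV[R]_d) (k : nat) :
    T -> 'M[R]_(d, n.+1) :=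
  fun w => \matrix_(i, j) if (j <= k)%N then X j w i 0 else 0.

Definition path_step (k : 'I_n) :
    'M[R]_(d, n.+1) -> 'cV[R]_q -> 'M[R]_(d, n.+1) :=
  step (theta k) (widen_ord (leqnSn n) k) (lift ord0 k).

Lemma stopped_path0 V x0 X : arch theta V x0 X ->
  stopped_path X 0 = fun w => x0 w *m delta_mx (0 : 'I_1) (ord0 : 'I_n.+1).
Proof.
move=> [X_0 _]; apply/funext => w; apply/matrixP => i j.
rewrite !mxE big_ord1 !mxE eqxx/= leqn0.
have [->|j0] := eqVneq j ord0; first by rewrite X_0 mulr1.
rewrite mulr0; case: ifP => // /eqP jE; case/eqP: j0; exact: val_inj.
Qed.

Lemma stopped_pathS V x0 X (k : 'I_n) : arch theta V x0 X ->
  stopped_path X k.+1 = fun w => path_step k (stopped_path X k w) (V k w).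
Proof.
move=> [_ XS]; apply/funext => w.
have colk : col (widen_ord (leqnSn n) k) (stopped_path X k w) =
    X (widen_ord (leqnSn n) k) w.
  by apply/colP => i; rewrite !mxE /= leqnn.
rewrite /path_step /step colk -XS; apply/matrixP => i j.
rewrite !mxE big_ord1 !mxE eqxx/=.
have [->|jk] := eqVneq j (lift ord0 k).
  by rewrite /= /bump leq0n leqnn ltnn mulr1 add0r.
rewrite mulr0 addr0 leq_eqVlt ltnS.
case: eqP => // jE; case/eqP: jk; apply: val_inj.
by rewrite /= /bump leq0n jE.
Qed.

Lemma stopped_pathn X : stopped_path X n = path_mx X.
Proof.
by apply/funext => w; apply/matrixP => i j; rewrite !mxE -ltnS ltn_ord.
Qed.

Definition noise_event (B : 'I_n -> set 'cV[R]_q) : set T :=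
  \bigcap_(j in setT) (Z j @^-1` B j).

Lemma noise_event_measurable B : (forall j, measurable (B j)) ->
  measurable (noise_event B).
Proof.
move=> mB; apply: fin_bigcap_measurable => // j _.
by rewrite -[X in measurable X]setTI; exact: mZ.
Qed.

Lemma noise_event_prob B : (forall j, measurable (B j)) ->
  P (noise_event B) = (\prod_j P (Z j @^-1` B j))%E.
Proof.
move=> mB; have := Z_indep [set: 'I_n]%SET mB.
rewrite (_ : [set` [set: 'I_n]%SET] = setT).
  by move=> ->; apply: eq_bigl => j; rewrite finset.inE.
by apply/seteqP; split => // j _ /=; rewrite finset.inE.
Qed.

(** The events of the future noise are the [noise_event B] with [B j] trivial
    for [j < k]. *)
Definition independent_future (k : nat) (Y : T -> 'M[R]_(d, n.+1)) :=
  forall A B, measurable A -> (forall j, measurable (B j)) ->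
  (forall j : 'I_n, (j < k)%N -> B j = setT) ->
  P (Y @^-1` A `&` noise_event B) = (P (Y @^-1` A) * P (noise_event B))%E.

Lemma independent_future0 (g : 'cV[R]_d -> 'cV[R]_d) : measurable_fun setT g ->
  independent_future 0
    (fun w => g (X0 w) *m delta_mx (0 : 'I_1) (ord0 : 'I_n.+1)).
Proof.
move=> mg A B mA mB _.
pose h x := g x *m delta_mx (0 : 'I_1) (ord0 : 'I_n.+1).
have mh : measurable_fun setT h by exact: measurable_mulmx.
have mA' : measurable (h @^-1` A) by rewrite -[X in measurable X]setTI; exact: mh.
pose C := \bigcap_(j in [set: 'I_n])
  ((fun M : 'M[R]_(q, n) => col j M) @^-1` B j).
have mC : measurable C.
  apply: fin_bigcap_measurable => // j _; rewrite -[X in measurable X]setTI.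
  by apply: (measurable_col j (@measurable_id _ _ _)).
have -> : noise_event B = path_mx Z @^-1` C.
  have colZ w j : col j (path_mx Z w) = Z j w by apply/colP => i; rewrite !mxE.
  by apply/seteqP; split => w Bw j _ /=; have := Bw j I; rewrite /= colZ.
exact: X0_indep mA' mC.
Qed.

Lemma independent_future_noise (k : 'I_n) Y : independent_future k Y ->
  forall A C, measurable A -> measurable C ->
  P (Y @^-1` A `&` Z k @^-1` C) = (P (Y @^-1` A) * P (Z k @^-1` C))%E.
Proof.
move=> indY A C mA mC; pose B j := if j == k then C else setT.
have mB j : measurable (B j) by rewrite /B; case: ifP.
have BE : noise_event B = Z k @^-1` C.
  apply/seteqP; split => w; first by move=> /(_ k I); rewrite /= /B eqxx.
  by move=> Cw j _; rewrite /= /B; case: eqP => // ->.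
rewrite -BE indY// => j jk; rewrite /B; case: eqP => // jE.
by rewrite jE ltnn in jk.
Qed.

(** The future noise is independent of the pair of [Y] and [Z k]: on rectangles,
    the event on [Z k] is merged into the noise event and the product rule is
    applied twice; then [independent_rectangles] extends this to all Borel
    sets. *)
Lemma independent_futureS (k : 'I_n) Y
    (h : 'M[R]_(d, n.+1) * 'cV[R]_q -> 'M[R]_(d, n.+1)) :
  measurable_fun setT Y -> measurable_fun setT h -> independent_future k Y ->
  independent_future k.+1 (fun w => h (Y w, Z k w)).
Proof.
move=> mY mh indY A B mA mB BT.
have mD := noise_event_measurable mB.
have mhA : measurable (h @^-1` A) by rewrite -[X in measurable X]setTI; exact: mh.
apply: (independent_rectangles mY (mZ k) mD _ mhA) => A1 C mA1 mC.
rewrite (independent_future_noise indY)//.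
pose B' j := if j == k then C else B j.
have mB' j : measurable (B' j) by rewrite /B'; case: ifP.
have BkT : B k = setT by exact: BT.
have -> : Y @^-1` A1 `&` Z k @^-1` C `&` noise_event B =
    Y @^-1` A1 `&` noise_event B'.
  rewrite -setIA; congr (_ `&` _); apply/seteqP; split => w.
    move=> [Cw Bw] j _; rewrite /= /B'; case: eqP => [->//|_]; exact: Bw.
  move=> B'w; split; first by have := B'w k I; rewrite /= /B' eqxx.
  move=> j _; have := B'w j I; rewrite /= /B'; case: eqP => [-> _|//].
  by rewrite BkT.
rewrite indY// => [|j jk]; last first.
  rewrite /B'; case: eqP => [jE|_]; first by rewrite jE ltnn in jk.
  by apply: BT; rewrite ltnS ltnW.
rewrite !noise_event_prob// -muleA; congr (_ * _)%E.
rewrite (bigD1 k)//= [in RHS](bigD1 k)//=.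
rewrite BkT preimage_setT probability_setT mul1e.
rewrite /B' eqxx; congr (_ * _)%E.
by apply: eq_bigr => j /negbTE jk; rewrite jk.
Qed.

(** What the induction along the time steps needs to know about the stopped
    path at time [k]. *)
Definition adapted (k : nat) (Y : T -> 'M[R]_(d, n.+1)) :=
  [/\ measurable_fun setT Y, integrable_mx P Y & independent_future k Y].

Section driven.
Variable f : 'I_n -> 'cV[R]_q -> 'cV[R]_q.
Hypotheses (mf : forall k, measurable_fun setT (f k))
  (if_ : forall k, integrable_mx P (f k \o Z k)).

Let mstep k : measurable_fun setT
  (fun yz : 'M[R]_(d, n.+1) * 'cV[R]_q => path_step k yz.1 (f k yz.2)).
Proof.
have m1 : measurable_fun setT (fun yz : 'M[R]_(d, n.+1) * 'cV[R]_q => yz.1).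
  exact: measurable_fst.
have mc : measurable_fun setT (fun yz : 'M[R]_(d, n.+1) * 'cV[R]_q =>
    col (widen_ord (leqnSn n) k) yz.1) by exact: measurable_col.
apply: measurable_mxD => //; apply: measurable_mulmx => //.
apply: measurable_mxD => //; apply: measurable_mulmx.
  exact: (measurableT_comp (theta_borel k) mc).
exact: (measurableT_comp (mf k) measurable_snd).
Qed.

(** The bound of [step_norm_le] separates the past from the noise, so that
    independence makes the product integrable. *)
Lemma adapted_step (k : 'I_n) Y : adapted k Y ->
  adapted k.+1 (fun w => path_step k (Y w) (f k (Z k w))).
Proof.
move=> [mY iY indY].
have mY' : measurable_fun setT (fun w => path_step k (Y w) (f k (Z k w))).
  have mYZ : measurable_fun setT (fun w => (Y w, Z k w)).
    by apply/measurable_fun_pairP; split; [exact: mY|exact: mZ].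
  exact: (measurableT_comp (mstep k) mYZ).
split=> //; last exact: (independent_futureS mY (mstep k) indY).
have [C C0 stepC] :=
  step_norm_le (widen_ord (leqnSn n) k) (lift ord0 k) (theta_growth k).
have mfZ : measurable_fun setT (f k \o Z k) by exact: measurableT_comp.
have nY := integrable_mx_norm mY iY; have nZ := integrable_mx_norm mfZ (if_ k).
have iYZ : integrableR P (fun w => (1 + `|Y w|) * (C * (1 + `|f k (Z k w)|))).
  apply: (independent_integrableM mY (mZ k) (independent_future_noise indY)
    (f := fun y : 'M[R]_(d, n.+1) => 1 + `|y|)
    (g := fun z => C * (1 + `|f k z|))).
  - apply: continuous_mx_measurable => y.
    exact: (cvgD (cvg_cst (1 : R)) (@norm_continuous _ _ y)).
  - have mn : measurable_fun setT (fun z : 'cV[R]_q => C * (1 + `|z|)).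
      apply: continuous_mx_measurable => y.
      exact: (cvgM (cvg_cst C) (cvgD (cvg_cst (1 : R)) (@norm_continuous _ _ y))).
    exact: (measurableT_comp mn (mf k)).
  - by apply: integrableRD => //; exact: integrableR_cst.
  - by apply: integrableRZ; apply: integrableRD => //; exact: integrableR_cst.
move=> i j.
apply: (integrableR_le
  (f := fun w => path_step k (Y w) (f k (Z k w)) i j)) iYZ _.
  exact: measurable_mxE.
by move=> w; apply: le_trans (entry_le_norm _ _ _) _; exact: stepC.
Qed.

Lemma adapted_Rintegral (k : 'I_n) Y phi : adapted k Y -> cvx_lip phi ->
  let E y := \int[P]_w phi (path_step k y (f k (Z k w))) in
  integrableR P (fun w => E (Y w)) /\
  \int[P]_w phi (path_step k (Y w) (f k (Z k w))) = \int[P]_w E (Y w).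
Proof.
move=> adY cphi; have [mY iY indY] := adY.
have [mY' iY' _] := adapted_step adY.
apply: (independent_Rintegral mY (mZ k) (independent_future_noise indY)
  (H := fun yz => phi (path_step k yz.1 (f k yz.2)))).
- exact: (cvx_lip_measurable cphi (mstep k)).
- exact: (cvx_lip_integrable cphi mY' iY').
- move=> y; have mfZ := measurableT_comp (mf k) (mZ k).
  exact: (step_integrable _ _ _ mfZ (if_ k) y cphi).
Qed.

Lemma stopped_path_adapted g X k : measurable_fun setT g ->
  integrable_mx P (g \o X0) -> arch theta (fun k w => f k (Z k w)) (g \o X0) X ->
  (k <= n)%N -> adapted k (stopped_path X k).
Proof.
move=> mg ig Xarch; elim: k => [_|k IH kn].
  rewrite (stopped_path0 Xarch); split.
  - by apply: measurable_mulmx => //; exact: measurableT_comp.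
  - move=> i j.
    have := integrableRZ (delta_mx (0 : 'I_1) (ord0 : 'I_n.+1) 0 j) (ig i 0).
    by apply: eq_integrable => // w _; rewrite /= !mxE big_ord1 mxE mulrC.
  - exact: independent_future0.
rewrite (@stopped_pathS _ _ _ (Ordinal kn) Xarch); apply: adapted_step.
exact: IH (ltnW kn).
Qed.

End driven.

Hypotheses (iZ : forall k, integrable_mx P (Z k))
  (rZ : forall k, radial P (Z k))
  (theta_convex : forall k, matrix_convex (theta k))
  (iX0 : integrable_mx P X0).

(** The induction on [k] is on stopped paths and ranges over all Lipschitz convex
    [phi], because the step replaces [phi] by its [transition].  Only the
    transition of the original noise has to be convex. *)
Theorem arch_cvx_le f g X Xh : 
  (forall k, measurable_fun setT (f k)) ->
  (forall k, integrable_mx P (f k \o Z k)) ->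
  (forall k (psi : 'cV[R]_q -> R), cvx_lip psi ->
    \int[P]_w psi (f k (Z k w)) <= \int[P]_w psi (Z k w)) ->
  measurable_fun setT g -> cvx_le P (g \o X0) X0 ->
  arch theta Z X0 X -> arch theta (fun k w => f k (Z k w)) (g \o X0) Xh ->
  cvx_le P (path_mx Xh) (path_mx X).
Proof.
move=> mf if_ fle mg [ig _ gle] Xarch Xharch.
have adX k : (k <= n)%N -> adapted k (stopped_path X k).
  by apply: (@stopped_path_adapted (fun=> id) _ _ id).
have adXh k : (k <= n)%N -> adapted k (stopped_path Xh k).
  by apply: (@stopped_path_adapted f _ _ g).
suff main k : (k <= n)%N -> forall phi, cvx_lip phi ->
    \int[P]_w phi (stopped_path Xh k w) <= \int[P]_w phi (stopped_path X k w).
  rewrite -!stopped_pathn; have [mX iX _] := adX n (leqnn n).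
  have [mXh iXh _] := adXh n (leqnn n).
  by apply: cvx_le_of_lip => //; exact: main.
elim: k => [_ phi cphi|k IH kn phi cphi].
  rewrite (stopped_path0 Xarch) (stopped_path0 Xharch).
  pose psi (x : 'cV[R]_d) := phi (x *m delta_mx (0 : 'I_1) (ord0 : 'I_n.+1)).
  have cpsi : cvx_lip psi.
    have := cvx_lip_column (ord0 : 'I_n.+1) 0 0 cphi.
    by congr cvx_lip; apply/funext => x; rewrite !add0r.
  have := gle psi ((convex_functionP _).2 cpsi.1); rewrite !unlock.
  rewrite -!RintegralE ?lee_fin//; apply: cvx_lip_integrable => //.
  exact: measurableT_comp.
pose k' := Ordinal kn.
pose E := transition P (theta k') (widen_ord (leqnSn n) k') (lift ord0 k')
  (Z k') phi.
have cE : cvx_lip E by exact: transition_cvx_lip.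
rewrite (@stopped_pathS _ _ _ k' Xarch) (@stopped_pathS _ _ _ k' Xharch).
have [_ ->] := @adapted_Rintegral (fun=> id) (fun=> @measurable_id _ _ setT) iZ
  k' _ phi (adX k (ltnW kn)) cphi.
have [iEh ->] := @adapted_Rintegral f mf if_ k' _ phi (adXh k (ltnW kn)) cphi.
apply: le_trans (IH (ltnW kn) _ cE).
have [mXh iXh _] := adXh k (ltnW kn).
apply: le_Rintegral => //; first exact: cvx_lip_integrable.
move=> w _; exact: (fle _ _ (cvx_lip_step _ _ _ _ cphi)).
Qed.

End process.

(** * Truncation, quantization and the scalar case *)

(** With the sign [o] making [theta x] and [o * theta y] agree in sign, the square
    of [a * theta x + (1 - a) * o * theta y] is that of the combination of the
    absolute values. *)
Lemma scalar_matrix_convex (R : realType) (d q : nat)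
    (theta : 'cV[R]_d -> 'M[R]_(d, q)) : d = 1%N -> q = 1%N ->
  (forall i j, convex_function [set: convex_lmodType 'cV[R]_d]
     (fun x : 'cV[R]_d => `|theta x i j|)) ->
  matrix_convex theta.
Proof.
move=> d1 q1; subst d q => /(_ 0 0)/convex_functionP cth x y a a01.
pose tx := theta x 0 0; pose ty := theta y 0 0.
pose o : R := if 0 <= tx * ty then 1 else -1.
have o2 : o ^+ 2 = 1 by rewrite /o; case: ifP; rewrite ?sqrrN expr1n.
have oE : tx * ty * o = `|tx| * `|ty|.
  rewrite -normrM /o; case: ifPn => [xy|]; first by rewrite mulr1 ger0_norm.
  by rewrite -ltNge => xy; rewrite mulrN1 ltr0_norm.
exists o%:M; first by rewrite /orthogonal_mx tr_scalar_mx -scalar_mxM -expr2 o2.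
have := cth x y a a01; set z := a *: x + (1 - a) *: y => /= tle.
apply/psd_leP => u; rewrite !sqnorm_trmul !sqnormE !big_ord1.
have E (M : 'M[R]_1) : (M^T *m u) 0 0 = M 0 0 * u 0 0.
  by rewrite mxE big_ord1 mxE.
rewrite !E !exprMn ler_wpM2r ?sqr_ge0//.
rewrite mxDE !mxZE mul_mx_scalar mxZE -/tx -/ty.
have -> : (a * tx + (1 - a) * (o * ty)) ^+ 2 = (a * `|tx| + (1 - a) * `|ty|) ^+ 2.
  have -> : (a * tx + (1 - a) * (o * ty)) ^+ 2 =
    a ^+ 2 * tx ^+ 2 + (1 - a) ^+ 2 * (o ^+ 2 * ty ^+ 2)
    + 2 * a * (1 - a) * (tx * ty * o) by ring.
  rewrite oE o2 -(real_normK (num_real tx)) -(real_normK (num_real ty)).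
  by ring.
rewrite -(real_normK (num_real (theta z 0 0))) lerXn2r ?nnegrE//.
exact: le_trans tle.
Qed.

Section replaced_noise.
Context {R : realType} {dT : measure_display} {T : measurableType dT}.
Variable P : probability T R.
Context {q : nat}.
Variable Z : T -> 'cV[R]_q.
Hypotheses (mZ : measurable_fun setT Z) (iZ : integrable_mx P Z).

Definition truncate (A : set 'cV[R]_q) (z : 'cV[R]_q) : 'cV[R]_q :=
  (\1_A z : R) *: z.

Lemma measurable_truncate A : measurable A -> measurable_fun setT (truncate A).
Proof.
move=> mA; apply: measurable_mx => i j; under eq_fun do rewrite mxE.
by apply: measurable_funM; [exact: measurable_indic|exact: measurable_entry].
Qed.

Lemma integrable_truncate A : measurable A -> integrable_mx P (truncate A \o Z).
Proof.
move=> mA i j; apply: (integrableR_le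
  (f := fun w => truncate A (Z w) i j) (g := fun w => `|Z w i j|)).
- by apply: measurable_mxE; exact: (measurableT_comp (measurable_truncate mA) mZ).
- by apply: integrableR_norm; exact: iZ.
move=> w; rewrite mxE normrM ler_piMl// indicE.
by case: (_ \in _); rewrite ?normr1// normr0.
Qed.

(** The only atom created by truncation is [0].  Its barycentre condition amounts
    to [Z] and the truncated noise having equal means, since the two coincide
    where the truncated noise is nonzero. *)
Lemma truncate_Rintegral_le A : measurable A ->
  (forall i, \int[P]_w Z w i 0 = 0) ->
  (forall i, \int[P]_w truncate A (Z w) i 0 = 0) ->
  forall psi : 'cV[R]_q -> R, cvx_lip psi ->
  \int[P]_w psi (truncate A (Z w)) <= \int[P]_w psi (Z w).
Proof.
move=> mA Z0 ZA0; have mtA := measurable_truncate mA.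
have itA := integrable_truncate mA.
apply: (@stationary_Rintegral_le _ _ _ P _ Z (truncate A) [:: 0]) => //.
  move=> z; rewrite /truncate indicE; case: (_ \in _).
    by right; rewrite scale1r.
  by left; rewrite scale0r inE.
move=> g; rewrite inE => /eqP -> i.
transitivity (\int[P]_w (Z w i 0 - truncate A (Z w) i 0)).
  apply: eq_Rintegral => w _; rewrite mxE subr0 !indicE /truncate mxE indicE.
  have [ZA|ZA] := boolP (Z w \in A); last first.
    by rewrite mul0r subr0 mem_set ?mul1r//= indicE (negbTE ZA) scale0r.
  rewrite mul1r subrr.
  have [Zw0|Zw0] := eqVneq (Z w) 0; first by rewrite Zw0 mxE mulr0.
  rewrite memNset ?mul0r//= indicE ZA scale1r; exact/eqP.
rewrite RintegralB//; last 2 first.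
- exact: iZ.
- exact: itA.
by rewrite Z0 ZA0 subrr.
Qed.

(** A quantization takes finitely many values, and stationarity is the condition
    on barycentres at each of them. *)
Lemma stationary_voronoi_Rintegral_le (proj : 'cV[R]_q -> 'cV[R]_q)
    (Gam : set 'cV[R]_q) :
  measurable_fun setT proj -> finite_set Gam -> (forall z, Gam (proj z)) ->
  cond_expectation P Z (proj \o Z) (proj \o Z) ->
  forall psi : 'cV[R]_q -> R, cvx_lip psi ->
  \int[P]_w psi (proj (Z w)) <= \int[P]_w psi (Z w).
Proof.
move=> mproj /finite_seqP[s ->] projs [_ iproj projE].
apply: (@stationary_Rintegral_le _ _ _ P _ Z proj s) => //.
  by move=> z; left; exact: projs.
move=> g _ i; have := projE _ (measurable_mx_set1 g) i.
set D := _ @^-1` _ => /(congr1 fine).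
rewrite -![fine _]/(\int[P]_(w in D) _).
rewrite [LHS]Rintegral_mkcond [RHS]Rintegral_mkcond => projD.
have mD : measurable D.
  rewrite -[D]setTI; apply: (measurableT_comp mproj mZ) => //.
  exact: measurable_mx_set1.
have iD (f : T -> R) : integrableR P f -> integrableR P (f \_ D).
  move=> fi; apply: (integrableR_le (g := fun w => `|f w|)).
  - apply/measurable_restrict => //; apply: measurable_funTS.
    exact: integrableR_measurable fi.
  - exact: integrableR_norm.
  - by move=> w; rewrite patchE; case: ifP => //; rewrite normr0.
have : \int[P]_w (((fun w => Z w i 0) \_ D) w -
    ((fun w => proj (Z w) i 0) \_ D) w) = 0.
  rewrite RintegralB//; last 2 first.
  - by apply: iD; exact: iZ.
  - by apply: iD; exact: iproj.
  by rewrite -projD subrr.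
move=> <-; apply: eq_Rintegral => w _; rewrite !patchE indicE.
have -> : (w \in [set w | proj (Z w) = g]) = (w \in D) by [].
have [/set_mem|_] := boolP (w \in D); last by rewrite mul0r subrr.
by rewrite /D /= => ->; rewrite mul1r.
Qed.

End replaced_noise.

Theorem theorem3p1 (R : realType) (dT : measure_display)
    (T : measurableType dT) (P : probability T R) (d q n : nat)
    (hd : (0 < d)%N) (hq : (0 < q)%N) (hn : (0 < n)%N)
    (X0 : {RV P >-> 'cV[R]_d}) (Z : 'I_n -> {RV P >-> 'cV[R]_q})
    (theta : 'I_n -> 'cV[R]_d -> 'M[R]_(d, q))
    (g0 : 'cV[R]_d -> 'cV[R]_d)
    (X : 'I_n.+1 -> T -> 'cV[R]_d)
    (X_arch : arch theta (fun k => Z k) X0 X)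
    (Z_white : white_noise Z)
    (Z_radial : forall k, radial P (Z k))
    (Z_indep_X0 : independent_mx P X0 (path_mx (fun k => Z k)))
    (X0_integrable : integrable_mx P X0)
    (theta_borel : forall k, measurable_fun setT (theta k))
    (theta_growth : forall k, linear_growth (theta k))
    (g0_borel : measurable_fun setT g0)
    (g0_bounded : bounded_vfun g0)
    (g0_cvx : cvx_le P (g0 \o X0) X0) :
  [/\ (* (a) *)
      (forall k, matrix_convex (theta k)) ->
        truncation_cvx_le P theta (fun k => Z k) (g0 \o X0) X,
      (* (b) *)
      (forall k, matrix_convex (theta k)) ->
        quantization_cvx_le P theta (fun k => Z k) (g0 \o X0) X &
      (* (c); when d = q = 1, [theta k x i j] is the only entry *)
      d = 1%N -> q = 1%N ->
      (forall k i j, convex_function [set: convex_lmodType 'cV[R]_d]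
         (fun x : 'cV[R]_d => `|theta k x i j|)) ->
        truncation_cvx_le P theta (fun k => Z k) (g0 \o X0) X /\
        quantization_cvx_le P theta (fun k => Z k) (g0 \o X0) X].
Proof.
have [Z_indep Z2 Z0 _] := Z_white.
have mZ k : measurable_fun setT (Z k) by exact: measurable_funP.
have mX0 : measurable_fun setT X0 by exact: measurable_funP.
have iZ k : integrable_mx P (Z k).
  move=> i j; rewrite ord1; apply/Lfun1_integrable.
  exact: (Lfun_subset12 (fin_num_measure P _ measurableT) (Z2 k i)).
have core f Xh (cth : forall k, matrix_convex (theta k)) :=
  @arch_cvx_le _ _ _ P _ _ _ X0 (fun k => Z k) theta mX0 mZ Z_indep Z_indep_X0
    theta_borel theta_growth iZ Z_radial cth X0_integrable f g0 X Xh.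
have HA : (forall k, matrix_convex (theta k)) ->
    truncation_cvx_le P theta (fun k => Z k) (g0 \o X0) X.
  move=> cth A XA mA EA XAarch.
  apply: (core (fun k => truncate (A k)) _ cth) => //.
  - by move=> k; exact: measurable_truncate.
  - by move=> k; exact: integrable_truncate.
  - move=> k; apply: truncate_Rintegral_le => // i.
      by have := Z0 k i; rewrite unlock => /(congr1 fine).
    by have := EA k i; rewrite unlock => /(congr1 fine).
have HB : (forall k, matrix_convex (theta k)) ->
    quantization_cvx_le P theta (fun k => Z k) (g0 \o X0) X.
  move=> cth Zh Xh ZhP Xharch.
  have /choice[proj projP] : forall k, exists proj : 'cV[R]_q -> 'cV[R]_q,
      exists Gam, [/\ finite_set Gam, measurable_fun setT proj,
        forall z, Gam (proj z) & Zh k = proj \o Z k].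
    move=> k; have [[Gam [proj [fG mp np ->]]] _] := ZhP k.
    by exists proj, Gam; split=> // z; have [] := np z.
  have ZhE : Zh = fun k w => proj k (Z k w).
    by apply/funext => k; have [? [_ _ _ ->]] := projP k.
  have ce k : cond_expectation P (Z k) (proj k \o Z k) (proj k \o Z k).
    by have [_] := ZhP k; rewrite ZhE.
  rewrite ZhE in Xharch.
  apply: (core proj _ cth) => //.
  - by move=> k; have [? []] := projP k.
  - by move=> k; have [] := ce k.
  - move=> k; have [Gam [fG mp Gp _]] := projP k.
    exact: (stationary_voronoi_Rintegral_le (mZ k) (iZ k) mp fG Gp (ce k)).
split=> // d1 q1 cth.
have cth' k : matrix_convex (theta k).
  by apply: scalar_matrix_convex => //; exact: cth.
by split; [exact: HA|exact: HB].
Qed.
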